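(* Let $S_R$ and $S_L$ be finite subgroups of $\mathrm{SO}(3)$, let $N\in\mathbb N$ and let $f\in\mathcal B_N(S_R\backslash\mathrm{SO}(3)/S_L)$, i.e. $f$ is an $N$-band-limited function on $\mathrm{SO}(3)$ with $f(R)=f(s_R\,R\,s_L)$ for all $R\in\mathrm{SO}(3)$, $s_R\in S_R$, $s_L\in S_L$. Let $\hat f=(\hat f_n^{k,l})_{(n,k,l)\in\mathcal J_N}$ be its harmonic coefficients and let $\hat g=\mathbf W_N\hat f=(\hat g_{k,j,l})_{k,j,l=-N}^N$. Then for any $r\in\mathbb N$: a) The following are equivalent: (i) $C_r\subseteq S_R$; (ii) if $k \bmod r\neq 0$ then $\hat f_n^{k,l}=0$, for all $(n,k,l)\in\mathcal J_N$; (iii) if $k\bmod r\neq 0$ then $\hat g_{k,j,l}=0$, for all $(k,j,l)\in\{-N,\dots,N\}^3$. b) The following are equivalent: (i) $D_r\subseteq S_R$; (ii) property a)(ii) holds and $\hat f_n^{k,l}=(-1)^{n+k}\hat f_n^{-k,l}$ for all $(n,k,l)\in\mathcal J_N$; (iii) property a)(iii) holds and $\hat g_{k,j,l}=(-1)^j\hat g_{-k,j,l}$ for all $(k,j,l)\in\{-N,\dots,N\}^3$. c) The following are equivalent: (i) $C_r\subseteq S_L$; (ii) if $l\bmod r\neq 0$ then $\hat f_n^{k,l}=0$, for all $(n,k,l)\in\mathcal J_N$; (iii) if $l\bmod r\neq 0$ then $\hat g_{k,j,l}=0$, for all $(k,j,l)\in\{-N,\dots,N\}^3$. d) The following are equivalent: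 (i) $D_r\subseteq S_L$; (ii) property c)(ii) holds and $\hat f_n^{k,l}=(-1)^{n+l}\hat f_n^{k,-l}$ for all $(n,k,l)\in\mathcal J_N$; (iii) property c)(iii) holds and $\hat g_{k,j,l}=(-1)^j\hat g_{k,j,-l}$ for all $(k,j,l)\in\{-N,\dots,N\}^3$.
   Context: $\mathbb T=\mathbb R/2\pi\mathbb Z$. $R_y(\cdot),R_z(\cdot)$ denote the rotations about the $y$- and $z$-axis, and $R(\alpha,\beta,\gamma)=R_z(\alpha)R_y(\beta)R_z(\gamma)$; every element of $\mathrm{SO}(3)$ has this form with $\alpha,\gamma\in\mathbb T$, $\beta\in[0,\pi]$. $L^2(\mathrm{SO}(3))$ is taken with respect to the Haar probability measure. Symmetries: for finite subgroups $S_R,S_L$ of $\mathrm{SO}(3)$, a function $f:\mathrm{SO}(3)\to\mathbb C$ is said to have right symmetry $S_R$ and left symmetry $S_L$ if $f(R)=f(s_R\,R\,s_L)$ for all $s_R\in S_R$, $s_L\in S_L$ (so, in this convention, $S_R$ acts by multiplication from the left of the argument and $S_L$ from the right). The double coset space is $S_R\backslash\mathrm{SO}(3)/S_L=\{S_R\,R\,S_L: R\in\mathrm{SO}(3)\}$, and $\mathcal B_N(S_R\backslash\mathrm{SO}(3)/S_L)$ denotes the functions in $\mathcal B_N$ (defined below) having right symmetry $S_R$ and left symmetry $S_L$. Cyclic group: $C_r=\{R_z(2\pi s/r): s=0,\dots,r-1\}$. Dihedral group: $D_r=\{P\,R_y(\pi s): P\in C_r,\ s=0,1\}$. Wigner-d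 functions: for $n\in\mathbb N_0$, $k,l\in\mathbb Z$, $|k|,|l|\le n$, and $x\in[-1,1]$, $$d_n^{k,l}(x)=(-1)^{\nu}\binom{2n-s}{s+a}^{1/2}\binom{s+b}{b}^{-1/2}\Big(\frac{1-x}2\Big)^{a/2}\Big(\frac{1+x}2\Big)^{b/2}P_s^{a,b}(x),$$ where $a=|k-l|$, $b=|k+l|$, $s=n-\max\{|k|,|l|\}$, $\nu=k+l$ if $k>l$ and $\nu=0$ otherwise, and $P_s^{a,b}$ is the Jacobi polynomial of degree $s$ with parameters $a,b$. Wigner-D functions: $D_n^{k,l}(R(\alpha,\beta,\gamma))=\sqrt{2n+1}\,e^{-\mathrm ik\alpha}\,d_n^{k,l}(\cos\beta)\,e^{-\mathrm il\gamma}$ for $\beta\in[0,\pi]$; they form an orthonormal basis of $L^2(\mathrm{SO}(3))$. $\mathcal J_N=\{(n,k,l): n=0,\dots,N,\ k,l=-n,\dots,n\}$; $\mathcal B_N=\operatorname{span}\{D_n^{k,l}:(n,k,l)\in\mathcal J_N\}$ is the space of $N$-band-limited functions; the harmonic coefficients of $f$ are $\hat f_n^{k,l}=\langle f,D_n^{k,l}\rangle_{L^2(\mathrm{SO}(3))}$. The Wigner transform is $$(\mathbf W_N\hat f)_{k,j,l}=\mathrm i^{k-l}\sum_{n=\max\{|k|,|l|,|j|\}}^{N}\sqrt{2n+1}\;d_n^{j,k}(0)\,d_n^{j,l}(0)\,\hat f_n^{-k,-l},\qquad k,j,l=-N,\dots,N;$$ its entries are the Fourier coefficients of $(\alpha,\beta,\gamma)\mapsto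 f(R(\alpha,\beta,\gamma))$ on $\mathbb T^3$ with respect to $e^{\mathrm i(k\alpha+j\beta+l\gamma)}$.
   Formalization: As stated (ii)⇒(i) fails (f=0, S_R trivial, r=2). Proved instead: (i)⇒(ii),(iii) for any S_R, S_L; (i)⇔(ii)⇔(iii) with S_R, S_L replaced by the full right/left symmetry groups of f; and the literal equivalences when S_R (resp. S_L) contains that full group. *)

(* Defs.v *)
From HB Require Import structures.
From mathcomp Require Import all_boot all_order all_algebra.
From mathcomp Require Import all_classical all_reals all_analysis.
From mathcomp Require Import complex.
From mathcomp Require Import ring lra zify.

Set Implicit Arguments.
Unset Strict Implicit.
Unset Printing Implicit Defensive.
Import Order.TTheory GRing.Theory Num.Theory.
Import numFieldNormedType.Exports.
Local Open Scope classical_set_scope.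
Local Open Scope ring_scope.

Section SO3.
Context {R : realType}.

Record SO3 : Type := MkSO3 {
  so3_mx :> 'M[R]_3;
  _ : (so3_mx *m so3_mx^T == 1%:M) && (\det so3_mx == 1) }.

HB.instance Definition _ := [isSub for so3_mx].
HB.instance Definition _ := [Choice of SO3 by <:].

Implicit Types g h : SO3.

Lemma so3_mulmxtr g : g *m g^T = 1%:M.
Proof. by case: g => A /= /andP[/eqP]. Qed.

Lemma so3_det g : \det g = 1.
Proof. by case: g => A /= /andP[_ /eqP]. Qed.

Lemma so3_trmulmx g : g^T *m g = 1%:M.
Proof. exact/mulmx1C/so3_mulmxtr. Qed.

Fact so3_one_subproof : ((1%:M : 'M[R]_3) *m 1%:M^T == 1%:M) &&
  (\det (1%:M : 'M[R]_3) == 1).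
Proof. by rewrite trmx1 mulmx1 det1 !eqxx. Qed.
Definition so3_one := MkSO3 so3_one_subproof.

Fact so3_mul_subproof g h :
  ((g *m h) *m (g *m h)^T == 1%:M) && (\det (g *m h) == 1).
Proof.
rewrite trmx_mul mulmxA -(mulmxA g) so3_mulmxtr mulmx1 so3_mulmxtr eqxx.
by rewrite det_mulmx !so3_det mulr1 eqxx.
Qed.
Definition so3_mul g h := MkSO3 (so3_mul_subproof g h).

Fact so3_inv_subproof g : (g^T *m g^T^T == 1%:M) && (\det g^T == 1).
Proof. by rewrite trmxK so3_trmulmx det_tr so3_det !eqxx. Qed.
Definition so3_inv g := MkSO3 (so3_inv_subproof g).

Fact so3_mulA : associative so3_mul.
Proof. by move=> x y z; apply: val_inj; rewrite /= mulmxA. Qed.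
Fact so3_mul1 : left_id so3_one so3_mul.
Proof. by move=> x; apply: val_inj; rewrite /= mul1mx. Qed.
Fact so3_1mul : right_id so3_one so3_mul.
Proof. by move=> x; apply: val_inj; rewrite /= mulmx1. Qed.
Fact so3_mulV : left_inverse so3_one so3_inv so3_mul.
Proof. by move=> x; apply: val_inj; rewrite /= so3_trmulmx. Qed.
Fact so3_Vmul : right_inverse so3_one so3_inv so3_mul.
Proof. by move=> x; apply: val_inj; rewrite /= so3_mulmxtr. Qed.

HB.instance Definition _ :=
  isGroup.Build SO3 so3_mulA so3_mul1 so3_1mul so3_mulV so3_Vmul.

HB.instance Definition _ := isPointed.Build SO3 so3_one.
HB.instance Definition _ := Topological.copy SO3 (initial_topology so3_mx).
HB.instance Definition _ :=
  Measurable.copy SO3 (g_sigma_algebraType (@open SO3)).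

End SO3.
Arguments SO3 : clear implicits.

Section Rotations.
Context {R : realType}.
Implicit Types (a b c : R) (g : SO3 R).

Definition mx3 (s : seq (seq R)) : 'M[R]_3 :=
  \matrix_(i < 3, j < 3) nth 0 (nth [::] s i) j.

Definition Rz_mx a : 'M[R]_3 := mx3
  [:: [:: cos a; - sin a; 0];
      [:: sin a; cos a; 0];
      [:: 0; 0; 1]].

Definition Ry_mx a : 'M[R]_3 := mx3
  [:: [:: cos a; 0; sin a];
      [:: 0; 1; 0];
      [:: - sin a; 0; cos a]].

Fact Rz_subproof a : (Rz_mx a *m (Rz_mx a)^T == 1%:M) && (\det (Rz_mx a) == 1).
Proof.
have cs := sin2cos2 a; apply/andP; split; apply/eqP.
  apply/matrixP => i j; rewrite !mxE !big_ord_recl big_ord0 !mxE.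
  case: i => [[|[|[|//]]] ?]; case: j => [[|[|[|//]]] ?] /=;
    rewrite ?mulr1n ?mulr0n; ring: cs.
rewrite (expand_det_row _ 0) !big_ord_recl big_ord0 /cofactor.
rewrite !(expand_det_row _ 0) !big_ord_recl !big_ord0 /cofactor !det_mx11 !mxE /=.
rewrite /bump /=; ring: cs.
Qed.

Fact Ry_subproof a : (Ry_mx a *m (Ry_mx a)^T == 1%:M) && (\det (Ry_mx a) == 1).
Proof.
have cs := sin2cos2 a; apply/andP; split; apply/eqP.
  apply/matrixP => i j; rewrite !mxE !big_ord_recl big_ord0 !mxE.
  case: i => [[|[|[|//]]] ?]; case: j => [[|[|[|//]]] ?] /=;
    rewrite ?mulr1n ?mulr0n; ring: cs.
rewrite (expand_det_row _ 0) !big_ord_recl big_ord0 /cofactor.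
rewrite !(expand_det_row _ 0) !big_ord_recl !big_ord0 /cofactor !det_mx11 !mxE /=.
rewrite /bump /=; ring: cs.
Qed.

Definition Rz a : SO3 R := MkSO3 (Rz_subproof a).
Definition Ry a : SO3 R := MkSO3 (Ry_subproof a).

Definition Reuler a b c : SO3 R := (Rz a * Ry b * Rz c)%g.

Definition cyclic_group (r : nat) : set (SO3 R) :=
  [set Rz (2 * pi * s%:R / r%:R) | s in `I_r].

Definition dihedral_group (r : nat) : set (SO3 R) :=
  [set (P * Ry (pi * s%:R))%g | P in cyclic_group r & s in `I_2].

Definition finite_subgroup (S : set (SO3 R)) : Prop :=
  [/\ finite_set S, S 1%g, forall s t, S s -> S t -> S (s * t)%g
    & forall s, S s -> S (s^-1)%g].

(* SO(3) is compact, so its Haar probability measure is bi-invariant. *)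
Definition is_haar (mu : probability (SO3 R) R) : Prop :=
  forall (g : SO3 R) (A : set (SO3 R)), measurable A ->
    mu [set (g * x)%g | x in A] = mu A /\ mu [set (x * g)%g | x in A] = mu A.

End Rotations.

Section Symmetries.
Context {R : realType}.
Implicit Types (f : SO3 R -> R[i]) (S G H : set (SO3 R)) (P Q : Prop).

(* "Right" symmetries act on the argument from the left, and vice versa. *)
Definition has_symmetry S_R S_L f : Prop :=
  forall g s t, S_R s -> S_L t -> f g = f (s * g * t)%g.

Definition right_symmetries f : set (SO3 R) :=
  [set s | forall g, f g = f (s * g)%g].
Definition left_symmetries f : set (SO3 R) :=
  [set t | forall g, f g = f (g * t)%g].

(* S is the prescribed symmetry group of a function and G its full symmetry
   group, so S `<=` G.  Properties P, Q of the function cannot yield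
   H `<=` S when S is smaller than G (e.g. f = 0 with S trivial): from P or Q
   one obtains H `<=` G, which is H `<=` S when S is the full group. *)
Definition symmetry_tfae S G H P Q : Prop :=
  [/\ H `<=` S -> P /\ Q,
      [<-> H `<=` G; P; Q]
    & G `<=` S -> [<-> H `<=` S; P; Q]].

End Symmetries.

Section Wigner.
Context {R : realType}.
Implicit Types (n s a b : nat) (k l : int) (x : R).

(* Rodrigues' formula expanded with Leibniz' rule. *)
Definition jacobi s a b : {poly R} :=
  \sum_(m < s.+1) ('C(s + a, s - m) * 'C(s + b, m))%:R *:
    ((2^-1 *: ('X - 1)) ^+ m * (2^-1 *: ('X + 1)) ^+ (s - m)).

Definition wignerd n k l x : R :=
  let a := absz (k - l)%R in
  let b := absz (k + l)%R in
  let s := (n - maxn (absz k) (absz l))%N in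
  let nu := if l < k then k + l else 0 in
  (-1) ^ nu * Num.sqrt 'C(2 * n - s, s + a)%:R / Num.sqrt 'C(s + b, b)%:R
  * ((1 - x) / 2) `^ (a%:R / 2) * ((1 + x) / 2) `^ (b%:R / 2)
  * (jacobi s a b).[x].

Definition expi x : R[i] := (cos x +i* sin x)%C.

Definition wignerD_angles n k l (alpha beta gamma : R) : R[i] :=
  (Num.sqrt (2 * n + 1)%:R)%:C%C * expi (- (k%:~R * alpha))
  * (wignerd n k l (cos beta))%:C%C * expi (- (l%:~R * gamma)).

(* Euler angles are not unique when sin beta = 0; see wignerDE. *)
Definition euler_angles (g : SO3 R) : R * R * R :=
  get [set p : R * R * R | 0 <= p.1.2 <= pi /\ g = Reuler p.1.1 p.1.2 p.2].

Definition wignerD n k l (g : SO3 R) : R[i] :=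
  let: (alpha, beta, gamma) := euler_angles g in
  wignerD_angles n k l alpha beta gamma.

End Wigner.

Section WellDefined.
Context {R : realType}.
Implicit Types (n : nat) (k l : int) (a b c p q : R).

Lemma expiD a b : expi (a + b) = expi a * expi b :> R[i].
Proof. by rewrite /expi cosD sinD (addrC (sin a * _)). Qed.

Lemma expi_neq0 a : expi a != 0 :> R[i].
Proof.
apply/eqP => /(congr1 (fun z => expi (- a) * z)).
by rewrite -expiD addNr mulr0 /expi cos0 sin0 => /eqP; rewrite oner_eq0.
Qed.

Lemma expiN a : expi (- a) = (expi a)^-1 :> R[i].
Proof.
apply: (mulIf (expi_neq0 a)).
by rewrite mulVf ?expi_neq0// -expiD addNr /expi cos0 sin0.
Qed.

Lemma expi_mulz k a : expi (k%:~R * a) = expi a ^ k :> R[i].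
Proof.
have nat (m : nat) : expi (m%:R * a) = expi a ^+ m :> R[i].
  elim: m => [|m IH]; first by rewrite mul0r /expi cos0 sin0.
  by rewrite -natr1 mulrDl mul1r expiD IH exprSr.
case: k => m; first exact: nat.
by rewrite NegzE mulrNz mulNr expiN nat exprnN.
Qed.

Lemma Reuler_entry a b c : let g : 'M[R]_3 := Reuler a b c in
  [/\ g 0 0 = cos a * cos b * cos c - sin a * sin c,
      g 1 0 = sin a * cos b * cos c + cos a * sin c,
      g 0 2%:R = cos a * sin b, g 1 2%:R = sin a * sin b
    & [/\ g 2%:R 0 = - (sin b * cos c), g 2%:R 1 = sin b * sin c
    & g 2%:R 2%:R = cos b]].
Proof.
by rewrite /=; split; last split; rewrite !(mxE, big_ord_recl, big_ord0) /=; ring.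
Qed.

Lemma wignerd1 n k l : k != l -> wignerd n k l 1 = 0 :> R.
Proof.
move=> kl; rewrite /wignerd subrr mul0r powR0 ?mulr0 ?mul0r//.
by rewrite mulf_neq0// ?invr_neq0// pnatr_eq0 ?absz_eq0 ?subr_eq0.
Qed.

Lemma wignerdN1 n k l : k != - l -> wignerd n k l (-1) = 0 :> R.
Proof.
move=> kl; rewrite /wignerd subrr mul0r (@powR0 _ (_ / 2)) ?mulr0 ?mul0r//.
by rewrite mulf_neq0// ?invr_neq0// pnatr_eq0 ?absz_eq0 ?addr_eq0.
Qed.

Lemma wignerD_angles_uniq n k l a b c a' b' c' :
  0 <= b <= pi -> 0 <= b' <= pi -> Reuler a b c = Reuler a' b' c' ->
  wignerD_angles n k l a b c = wignerD_angles n k l a' b' c'.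
Proof.
move=> hb hb' eg.
have := Reuler_entry a b c; rewrite eg /=.
have [-> -> -> -> [-> -> ->]] := Reuler_entry a' b' c'.
move=> [e1 e2 e3 e4 [e5 e6 /cos_inj]].
rewrite !in_itv /= => /(_ hb' hb) eb.
rewrite {}eb {b' hb' eg} in e1 e2 e3 e4 e5 e6 *.
rewrite /wignerD_angles -!mulNr -!mulrNz !expi_mulz.
have [sb|sb] := eqVneq (sin b) 0; last first.
  have -> : expi a = expi a' :> R[i].
    by congr (_ +i* _)%C; apply: (mulIf sb).
  have -> // : expi c = expi c' :> R[i].
    congr (_ +i* _)%C; apply: (mulfI sb) => //.
    exact: oppr_inj.
have ep (x y x' y' : R) m : expi (x + y) = expi (x' + y') :> R[i] ->
    expi x ^ m * expi y ^ m = expi x' ^ m * expi y' ^ m.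
  have pw (u v : R) : expi u ^ m * expi v ^ m = expi (u + v) ^ m.
    by rewrite expiD exprzMl ?unitfE ?expi_neq0.
  move=> e; apply: etrans (pw x y) _; rewrite e; exact/esym/pw.
have en (x : R) m : expi x ^ (- m) = expi (- x) ^ m.
  by rewrite expiN exprz_inv.
have mc (x y z : R[i]) : y = z -> x * y = x * z by move->.
have zr (x d y x' y' : R[i]) : d = 0 -> x * d * y = x' * d * y'.
  by move=> ->; rewrite !mulr0 !mul0r.
have swap (x y z t : R[i]) : x * y * z * t = x * z * (y * t) by ring.
rewrite [LHS]swap [RHS]swap.
have /eqP := sin0cos1 sb; rewrite eqr_norml ler01 andbT.
case/orP => /eqP cb; rewrite cb in e1 e2 *.
  have [<-|kl] := eqVneq k l; last first.
    by apply: zr; rewrite (wignerd1 _ kl).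
  have e : expi (a + c) = expi (a' + c') :> R[i].
    by rewrite /expi !cosD !sinD; congr (_ +i* _)%C; lra.
  by apply: mc; exact: (ep _ _ _ _ _ e).
have [->|kl] := eqVneq k (- l); last first.
  by apply: zr; rewrite (wignerdN1 _ kl).
have e : expi (a - c) = expi (a' - c') :> R[i].
  by rewrite /expi !cosB !sinB; congr (_ +i* _)%C; lra.
by apply: mc; rewrite opprK (en c) (en c'); exact: (ep _ _ _ _ _ e).
Qed.

(* The choice made in wignerD is immaterial. *)
Lemma wignerDE n k l a b c : 0 <= b <= pi ->
  wignerD n k l (Reuler a b c) = wignerD_angles n k l a b c.
Proof.
move=> hb; rewrite /wignerD /euler_angles; set P := [set p : _ | _].
have : P (get P) by apply: getPex; exists (a, b, c).
case: (get P) => -[a' b'] c' /= [hb' e].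
exact: wignerD_angles_uniq.
Qed.

End WellDefined.

Section Harmonic.
Context {R : realType}.
Implicit Types (f : SO3 R -> R[i]) (N n : nat) (k j l : int).

Definition Jset N n k l : bool :=
  [&& n <= N, absz k <= n & absz l <= n]%N.

Definition zball n : seq int := [seq i%:Z - n%:Z | i <- iota 0 (2 * n).+1].

Lemma mem_zball n k : (k \in zball n) = (absz k <= n)%N.
Proof.
apply/mapP/idP => [[m]|km]; first by rewrite mem_iota => ? ->; lia.
by exists (absz (k + n%:Z)%R); rewrite ?mem_iota; lia.
Qed.

(* The span of the D_n^{k,l} with (n, k, l) in Jset N. *)
Definition bandlimited N f : Prop :=
  exists c : nat -> int -> int -> R[i], forall g,
    f g = \sum_(0 <= n < N.+1) \sum_(k <- zball n) \sum_(l <- zball n)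
            c n k l * wignerD n k l g.

Variable mu : probability (SO3 R) R.

Definition cintegral f : R[i] :=
  ((\int[mu]_x complex.Re (f x)) +i* (\int[mu]_x complex.Im (f x)))%C.

Definition inner_prod f h : R[i] := cintegral (fun x => f x * (h x)^*%C).

Definition harmonic_coef f n k l : R[i] := inner_prod f (wignerD n k l).

End Harmonic.

Definition wigner_transform {R : realType} (N : nat)
    (fh : nat -> int -> int -> R[i]) (k j l : int) : R[i] :=
  'i%C ^ (k - l) *
  \sum_(maxn (absz k) (maxn (absz l) (absz j)) <= n < N.+1)
    (Num.sqrt (2 * n + 1)%:R * wignerd n j k 0 * wignerd n j l 0)%:C%C
    * fh n (- k) (- l).

(* Main.v *)
Require Import Defs.
From mathcomp Require Import all_boot all_order all_algebra.
From mathcomp Require Import all_classical all_reals all_analysis.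
From mathcomp Require Import complex.
From mathcomp Require Import ring lra zify.
Import Order.TTheory GRing.Theory Num.Theory.
Import numFieldNormedType.Exports.
Local Open Scope classical_set_scope.
Local Open Scope ring_scope.

Set Implicit Arguments.
Unset Strict Implicit.
Unset Printing Implicit Defensive.

(** The coefficients of f(h .) are <f, D(h^-1 .)> by invariance of mu, and for
    h = R_z(t), R_y(pi) the function D_n^{k,l}(h .) is a multiple of D_n^{k,l},
    D_n^{-k,l} respectively; so a symmetry of f gives (ii).  Conversely, if f
    and f(h .) have the same coefficients, then u = f(h .) - f is orthogonal to
    f and to f(h .), both of which lie in the span of the D_n^{k,l}, hence
    <u, u> = 0 and u = 0.  This needs neither the orthonormality of the D_n^{k,l}
    nor the full support of the Haar measure, only that the D_n^{k,l} are polynomials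
    in the matrix entries: almost every g satisfies u(h g) = 0 for all h with
    rational Euler angles, and one such g suffices by continuity.
    Finally (ii) and (iii) are equivalent because W_N is injective: for fixed
    k, l it is a triangular system with diagonal entries proportional to
    d_n^{n,k}(0) d_n^{n,l}(0) <> 0. *)

(** * Symmetries of the Wigner-d functions *)

Section WignerSmallD.
Context {R : realType}.
Implicit Types (n s a b : nat) (k l : int) (x : R).

(** Reversing the order of summation exchanges the two binomial coefficients and the two linear
    factors. Each of the [s] linear factors in a term contributes one sign when [x] becomes
    [- x]. *)
Lemma jacobiN s a b x : (jacobi s a b).[- x] = (-1) ^+ s * (jacobi s b a).[x].
Proof.
rewrite /jacobi !horner_sum mulr_sumr (reindex_inj rev_ord_inj) /=.
apply: eq_bigr => -[m /= ms] _; rewrite subSS.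
have -> : (s - (s - m) = m)%N by lia.
rewrite !hornerE /=.
have -> : 2^-1 * (- x - 1) = - (2^-1 * (x + 1)) by ring.
have -> : 2^-1 * (- x + 1) = - (2^-1 * (x - 1)) by ring.
rewrite (exprNn (2^-1 * (x + 1))) (exprNn (2^-1 * (x - 1))).
have -> : (-1 : R) ^+ s = (-1) ^+ (s - m) * (-1) ^+ m.
  by rewrite -exprD; congr (_ ^+ _); lia.
set u := 2^-1 * _; set v := 2^-1 * _.
by rewrite !natrM; ring.
Qed.

(** The quotient of the two binomials is (s+a+b)! s! / ((s+a)! (s+b)!), which is symmetric in [a]
    and [b]. *)
Lemma wigner_bin_sym n s a b : (2 * n - s = s + a + b)%N ->
  Num.sqrt 'C(2 * n - s, s + a)%:R / Num.sqrt 'C(s + b, b)%:R =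
  Num.sqrt 'C(2 * n - s, s + b)%:R / Num.sqrt 'C(s + a, a)%:R :> R.
Proof.
move=> ->.
have gt0 p q : (q <= p)%N -> 0 < Num.sqrt ('C(p, q)%:R : R).
  by move=> qp; rewrite sqrtr_gt0 ltr0n bin_gt0.
have n0 p q : (q <= p)%N -> Num.sqrt ('C(p, q)%:R : R) != 0.
  by move=> /gt0 /lt0r_neq0.
apply/eqP; rewrite eqr_div ?n0 ?leq_addl//; apply/eqP.
rewrite -!sqrtrM ?ler0n// -!natrM; congr (Num.sqrt _%:R).
have f0 p : (0 < p`!)%N by exact: fact_gt0.
have abs : (0 < a`! * b`! * s`!)%N by rewrite !muln_gt0 !f0.
have e1 := @bin_fact (s + a + b) (s + a) (leq_addr _ _).
have e2 := @bin_fact (s + a) a (leq_addl _ _).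
have e3 : ('C(s + a + b, s + b) * ((s + b)`! * a`!) = (s + a + b)`!)%N.
  by rewrite -(bin_fact (_ : s + b <= s + a + b)%N); [congr (_ * (_ * _`!))%N|]; lia.
have e4 := @bin_fact (s + b) b (leq_addl _ _).
rewrite addnK in e2; rewrite addnK in e4; rewrite addKn in e1.
apply/eqP; rewrite -(eqn_pmul2r abs); apply/eqP.
transitivity (s + a + b)`!; first by rewrite -e1 -e2; ring.
by rewrite -e3 -e4; ring.
Qed.

End WignerSmallD.

(** Turns every comparison of signs below into a parity question on integer exponents, which [lia]
    settles. *)
Lemma exprN1_parity (A : unitRingType) (k l : int) :
  ((k - l) %% 2)%Z = 0 -> (-1) ^ k = (-1) ^ l :> A.
Proof.
have abs (m : int) : (-1) ^ m = (-1) ^+ odd (absz m) :> A.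
 rewrite signr_odd; case: m => m //.
  by rewrite NegzE -exprnN -exprVn invrN1 abszN.
by move=> kl; rewrite !abs; congr (_ ^+ nat_of_bool _); lia.
Qed.

Section WignerSmallDSymmetry.
Context {R : realType}.
Implicit Types (n s a b : nat) (k l : int) (x : R).

(** Negating [k] exchanges [a] and [b], and negating [x] exchanges the bases (1-x)/2 and (1+x)/2.
    The normalising constant is symmetric in [a] and [b], so only the signs from the Jacobi
    polynomial and from [nu] remain. *)
Lemma wignerdN n k l x : (`|k| <= n)%N -> (`|l| <= n)%N ->
  wignerd n k l (- x) = (-1) ^ (n%:Z + l) * wignerd n (- k) l x.
Proof.
move=> kn ln; rewrite /wignerd jacobiN opprK abszN.
have -> : absz (- k - l)%R = absz (k + l)%R by lia.
have -> : absz (- k + l)%R = absz (k - l)%R by lia.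
set s := (n - _)%N; set a := absz (k - l)%R; set b := absz (k + l)%R.
have -> : (1 + - x) = 1 - x by [].
have hs : (2 * n - s = s + a + b)%N by rewrite /s /a /b; lia.
set nu := (X in (-1) ^ X * _ / _); set nu' := (X in (-1) ^ _ * ((-1) ^ X * _ / _ * _ * _ * _)).
have e : (-1 : R) ^ nu * (-1) ^+ s = (-1) ^ (n%:Z + l) * (-1) ^ nu'.
  rewrite exprnP -!expfzDr ?oppr_eq0 ?oner_eq0//; apply: exprN1_parity.
  by rewrite /nu /nu' /s; case: ifP; case: ifP; lia.
move: (wigner_bin_sym (R := R) hs).
move: (Num.sqrt _) (Num.sqrt _) (Num.sqrt _) (Num.sqrt _) => c1 c2 c3 c4 c.
set J := (jacobi s b a).[x]; set p := powR _ _; set q := powR _ _.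
transitivity ((-1) ^ nu * (-1) ^+ s * (c4 / c3 * p * q * J)); first by ring.
by rewrite e c; ring.
Qed.

(** The index pairs (-k, l) and (k, -l) give the same [a], [b] and [s]; only [nu] distinguishes
    them. *)
Lemma wignerd_oppl n k l x : (`|k| <= n)%N -> (`|l| <= n)%N ->
  wignerd n (- k) l x = (-1) ^ (k + l) * wignerd n k (- l) x.
Proof.
move=> kn ln; rewrite /wignerd !abszN opprK.
have -> : absz (- k - l)%R = absz (k + l)%R by lia.
have -> : absz (- k + l)%R = absz (k - l)%R by lia.
set nu := (X in (-1) ^ X * _ / _); set nu' := (X in (-1) ^ _ * ((-1) ^ X * _ / _ * _ * _ * _)).
rewrite !mulrA; congr (_ * _ * _ * _ * _ * _).
rewrite -!expfzDr ?oppr_eq0 ?oner_eq0//; apply: exprN1_parity.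
by rewrite /nu /nu'; case: ifP; case: ifP; lia.
Qed.

Lemma wignerdN_r n k l x : (`|k| <= n)%N -> (`|l| <= n)%N ->
  wignerd n k l (- x) = (-1) ^ (n%:Z + k) * wignerd n k (- l) x.
Proof.
move=> kn ln; rewrite wignerdN// wignerd_oppl// mulrA; congr (_ * _).
rewrite -expfzDr ?oppr_eq0 ?oner_eq0//; apply: exprN1_parity; lia.
Qed.

(** With first index [n] the degree [s] is 0 and the Jacobi polynomial is 1, so only powers of 1/2
    and the root of a positive binomial coefficient are left. These are the diagonal entries of the
    triangular system solved later. *)
Lemma wignerd_diag_neq0 n k : (`|k| <= n)%N -> wignerd n n%:Z k 0 != 0 :> R.
Proof.
move=> kn; rewrite /wignerd.
have -> : (n - maxn `|n%:Z| `|k| = 0)%N by lia.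
rewrite /jacobi big_ord1 !expr0 mulr1 bin0 bin0 muln1 scale1r hornerC !add0n binn sqrtr1.
rewrite subr0 addr0 divr1 subn0 mulr1.
rewrite !mulf_neq0 ?expfz_neq0 ?oppr_eq0 ?oner_eq0//.
by rewrite lt0r_neq0// sqrtr_gt0 ltr0n bin_gt0; lia.
Qed.

End WignerSmallDSymmetry.

(** * Polynomial functions on SO(3) *)

Section Topology.
Context {R : realType}.
Implicit Types (g h : SO3 R).

Lemma continuous_mx (T : topologicalType) m n (F : T -> 'M[R]_(m, n)) :
  (forall i j, continuous (fun x => F x i j)) -> continuous F.
Proof.
move=> cF x; apply/cvg_ballP => e e0.
have : \forall t \near x, forall i j, ball (F x i j) e (F t i j).
  apply: filter_forall => i; apply: filter_forall => j.
  exact: (cvg_ballP _ _).1 (cF i j x) e e0.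
by apply: filterS => t; split.
Qed.

Lemma continuous_cmul (T : topologicalType) (c : R) (F : T -> R) :
  continuous F -> continuous (fun x => c * F x).
Proof. by move=> cF x; apply: cvgM; [exact: cvg_cst|exact: cF]. Qed.

Lemma so3_entry_continuous i j : continuous (fun g => g i j).
Proof.
move=> g; apply: (@continuous_comp _ _ _ (@so3_mx R) (fun M : 'M[R]_3 => M i j)).
  exact: initial_continuous.
exact: coord_continuous.
Qed.

Lemma so3_continuous (F : SO3 R -> SO3 R) :
  (forall i j, continuous (fun g => F g i j)) -> continuous F.
Proof.
move=> cF; apply: (@continuous_comp_initial _ _ _ (@so3_mx R)).
exact: continuous_mx.
Qed.

Lemma so3_mul_entry g h i j : (g * h)%g i j = \sum_k g i k * h k j.
Proof. by rewrite mxE. Qed.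

Lemma so3_mull_continuous h : continuous (fun g => h * g)%g.
Proof.
apply: so3_continuous => i j; under eq_fun do rewrite so3_mul_entry.
apply: continuous_big => [|k _]; first exact: add_continuous.
by apply: continuous_cmul; exact: so3_entry_continuous.
Qed.

Lemma so3_mulr_continuous h : continuous (fun g => g * h)%g.
Proof.
apply: so3_continuous => i j; under eq_fun do rewrite so3_mul_entry.
apply: continuous_big => [|k _]; first exact: add_continuous.
under eq_fun do rewrite mulrC.
by apply: continuous_cmul; exact: so3_entry_continuous.
Qed.

Lemma so3_open_measurable (A : set (SO3 R)) : open A -> measurable A.
Proof. exact: sub_sigma_algebra. Qed.

Lemma so3_continuous_measurable (F : SO3 R -> SO3 R) :
  continuous F -> measurable_fun setT F.
Proof.
move=> /continuousP cF; apply: (measurability (@open (SO3 R))); first reflexivity.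
move=> _ [A oA <-]; rewrite setTI; apply: so3_open_measurable; exact: cF.
Qed.

Lemma so3_continuous_measurableR (F : SO3 R -> R) :
  continuous F -> measurable_fun setT F.
Proof.
move=> /continuousP cF; apply: (measurability _ (measurable_realfun.RGenOpens.measurableE R)).
move=> _ [_ [a [b ->]] <-]; rewrite setTI; apply: so3_open_measurable; apply: cF.
exact: interval_open.
Qed.

Lemma so3_entry_le1 g i j : `|g i j| <= 1.
Proof.
have /matrixP/(_ i i) := so3_mulmxtr g; rewrite !mxE eqxx mulr1n.
under eq_bigr do rewrite mxE -expr2.
rewrite (bigD1 j)//= => e; rewrite -(@expr_le1 _ 2)// real_normK ?num_real//.
by rewrite -e lerDl sumr_ge0// => k _; rewrite sqr_ge0.
Qed.

End Topology.

Section PolynomialFunctions.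
Context {R : realType}.
Implicit Types (g h : SO3 R) (u v : SO3 R -> R[i]).

(** Being inductive, this class gets its closure under translation and conjugation, its continuity
    and its boundedness by induction on the construction. Continuity and boundedness make every
    integral in the sequel finite. *)
Inductive polyfun : (SO3 R -> R[i]) -> Prop :=
| polyfun_cst c : polyfun (fun=> c)
| polyfun_entry i j : polyfun (fun g => (g i j)%:C%C)
| polyfunD u v : polyfun u -> polyfun v -> polyfun (fun g => u g + v g)
| polyfunM u v : polyfun u -> polyfun v -> polyfun (fun g => u g * v g).

Lemma polyfunX u n : polyfun u -> polyfun (fun g => u g ^+ n).
Proof.
move=> pu; elim: n => [|n IH]; first exact: polyfun_cst.
by under eq_fun do rewrite exprS; exact: polyfunM.
Qed.

Lemma polyfunZ c u : polyfun u -> polyfun (fun g => c * u g).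
Proof. by apply: polyfunM; exact: polyfun_cst. Qed.

Lemma polyfunB u v : polyfun u -> polyfun v -> polyfun (fun g => u g - v g).
Proof.
move=> pu pv; under eq_fun do rewrite -mulN1r.
by apply: polyfunD => //; exact: polyfunZ.
Qed.

Lemma polyfun_sum (I : eqType) (s : seq I) (F : I -> SO3 R -> R[i]) :
  (forall i, i \in s -> polyfun (F i)) -> polyfun (fun g => \sum_(i <- s) F i g).
Proof.
elim: s => [|a s IH] pF.
  by under eq_fun do rewrite big_nil; exact: polyfun_cst.
under eq_fun do rewrite big_cons; apply: polyfunD; first by apply: pF; rewrite mem_head.
by apply: IH => i si; apply: pF; rewrite inE si orbT.
Qed.

Lemma polyfun_conj u : polyfun u -> polyfun (fun g => (u g)^*%C).
Proof.
elim=> [c|i j|{}u v _ pu _ pv|{}u v _ pu _ pv].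
- exact: polyfun_cst.
- by under eq_fun do rewrite conjc_real; exact: polyfun_entry.
- by under eq_fun do rewrite rmorphD; exact: polyfunD.
- by under eq_fun do rewrite rmorphM; exact: polyfunM.
Qed.

Lemma polyfun_mull h u : polyfun u -> polyfun (fun g => u (h * g)%g).
Proof.
elim=> [c|i j|{}u v _ pu _ pv|{}u v _ pu _ pv].
- exact: polyfun_cst.
- under eq_fun do rewrite so3_mul_entry rmorph_sum; apply: polyfun_sum => k _.
  under eq_fun do rewrite rmorphM; apply: polyfunM; [exact: polyfun_cst|exact: polyfun_entry].
- exact: polyfunD.
- exact: polyfunM.
Qed.

Lemma polyfun_mulr h u : polyfun u -> polyfun (fun g => u (g * h)%g).
Proof.
elim=> [c|i j|{}u v _ pu _ pv|{}u v _ pu _ pv].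
- exact: polyfun_cst.
- under eq_fun do rewrite so3_mul_entry rmorph_sum; apply: polyfun_sum => k _.
  under eq_fun do rewrite rmorphM; apply: polyfunM; [exact: polyfun_entry|exact: polyfun_cst].
- exact: polyfunD.
- exact: polyfunM.
Qed.

Lemma ReD (x y : R[i]) : complex.Re (x + y) = complex.Re x + complex.Re y.
Proof. by case: x y => a b [c d]. Qed.

Lemma ImD (x y : R[i]) : complex.Im (x + y) = complex.Im x + complex.Im y.
Proof. by case: x y => a b [c d]. Qed.

Lemma ReM (x y : R[i]) : complex.Re (x * y) =
  complex.Re x * complex.Re y - complex.Im x * complex.Im y.
Proof. by case: x y => a b [c d]. Qed.

Lemma ImM (x y : R[i]) : complex.Im (x * y) =
  complex.Re x * complex.Im y + complex.Im x * complex.Re y.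
Proof. by case: x y => a b [c d]. Qed.

(** The parameter space is arbitrary so that both functions on the group and their restrictions to
    the curves [Rz t] and [Ry t] are covered. *)
Lemma polyfun_continuous (T : topologicalType) (p : T -> SO3 R) u :
  (forall i j, continuous (fun t => p t i j)) -> polyfun u ->
  continuous (fun t => complex.Re (u (p t))) /\
  continuous (fun t => complex.Im (u (p t))).
Proof.
move=> cp; elim=> [c|i j|{}u v _ [ru iu] _ [rv iv]|{}u v _ [ru iu] _ [rv iv]].
- by split=> x; exact: cvg_cst.
- by split=> [|x]; [exact: cp|exact: cvg_cst].
- split; [under eq_fun do rewrite ReD|under eq_fun do rewrite ImD] => x;
    apply: cvgD; [exact: ru|exact: rv|exact: iu|exact: iv].
- split; [under eq_fun do rewrite ReM|under eq_fun do rewrite ImM] => x.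
    by apply: cvgB; apply: cvgM; [exact: ru|exact: rv|exact: iu|exact: iv].
  by apply: cvgD; apply: cvgM; [exact: ru|exact: iv|exact: iu|exact: rv].
Qed.

Lemma polyfun_bounded u : polyfun u -> exists M : R,
  forall g, `|complex.Re (u g)| <= M /\ `|complex.Im (u g)| <= M.
Proof.
elim=> [c|i j|{}u v _ [M hu] _ [N hv]|{}u v _ [M hu] _ [N hv]].
- exists (`|complex.Re c| + `|complex.Im c|) => g.
  by rewrite lerDl lerDr !normr_ge0.
- by exists 1 => g; rewrite /= normr0 ler01 so3_entry_le1.
- exists (M + N) => g; rewrite ReD ImD; have [a b] := hu g; have [c d] := hv g.
  by split; rewrite (le_trans (ler_normD _ _))// lerD.
- exists (M * N + M * N) => g; rewrite ReM ImM; have [a b] := hu g; have [c d] := hv g.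
  by split; rewrite (le_trans (ler_normD _ _))// ?normrN !normrM lerD// ler_pM.
Qed.

End PolynomialFunctions.

(** * Haar integrals of polynomial functions *)

Section Integration.
Context {R : realType} (mu : probability (SO3 R) R).
Implicit Types (g h : SO3 R) (u v : SO3 R -> R[i]).

Lemma bounded_continuous_integrable (F : SO3 R -> R) (M : R) :
  continuous F -> (forall g, `|F g| <= M) -> mu.-integrable setT (EFin \o F).
Proof.
move=> cF FM; apply: measurable_bounded_integrable => //.
- by rewrite -ge0_fin_numE ?measure_ge0 ?fin_num_measure.
- exact: so3_continuous_measurableR.
- by exists M; split; rewrite ?num_real// => x Mx y _ /=; rewrite (le_trans (FM y))// ltW.
Qed.

Lemma polyfun_continuous_id u : polyfun u ->
  continuous (@complex.Re R \o u) /\ continuous (@complex.Im R \o u).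
Proof. by apply: polyfun_continuous => i j; exact: so3_entry_continuous. Qed.

Lemma polyfun_integrable u : polyfun u ->
  mu.-integrable setT (EFin \o (@complex.Re R \o u)) /\
  mu.-integrable setT (EFin \o (@complex.Im R \o u)).
Proof.
move=> pu; have [cr ci] := polyfun_continuous_id pu.
have [M uM] := polyfun_bounded pu.
by split; apply: (@bounded_continuous_integrable _ M) => // g; have [] := uM g.
Qed.

Lemma cintegralD u v : polyfun u -> polyfun v ->
  cintegral mu (fun g => u g + v g) = cintegral mu u + cintegral mu v.
Proof.
move=> /polyfun_integrable[ru iu] /polyfun_integrable[rv iv].
rewrite /cintegral; under eq_Rintegral do rewrite ReD.
under [X in (_ +i* X)%C]eq_Rintegral do rewrite ImD.
by rewrite !RintegralD.
Qed.

Lemma cintegralZ c u : polyfun u ->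
  cintegral mu (fun g => c * u g) = c * cintegral mu u.
Proof.
move=> /polyfun_integrable[ru iu].
have iZ (a : R) F : mu.-integrable setT (EFin \o F) ->
    mu.-integrable setT (EFin \o (fun g => a * F g)).
  by move=> iF; exact: (integrableZl measurableT a iF).
rewrite /cintegral; under eq_Rintegral do rewrite ReM.
under [X in (_ +i* X)%C]eq_Rintegral do rewrite ImM.
rewrite RintegralB ?RintegralD//; [|exact: iZ..].
by rewrite !RintegralZl//; case: c.
Qed.

Lemma cintegral0 : cintegral mu (fun=> 0) = 0.
Proof. by rewrite /cintegral Rintegral_cst// mul0r. Qed.

Lemma cintegral_transform (F : SO3 R -> SO3 R) u :
  measurable_fun setT F -> (forall A, measurable A -> mu (F @^-1` A) = mu A) ->
  polyfun u -> polyfun (u \o F) -> cintegral mu (u \o F) = cintegral mu u.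
Proof.
move=> mF Fmu /polyfun_integrable[ru iu] /polyfun_integrable[ruF iuF].
have iF (G : SO3 R -> R) : mu.-integrable setT (EFin \o G) ->
    mu.-integrable setT (EFin \o (G \o F)) ->
    \int[mu]_x (G (F x)) = \int[mu]_x G x.
  move=> /integrableP[mG _] iGF; congr fine.
  transitivity (\int[pushforward mu F]_x (EFin \o G) x)%E.
    by rewrite (integral_pushforward mF mG)//.
  by apply: eq_measure_integral => A mA _; exact: Fmu.
rewrite /cintegral; congr (_ +i* _)%C.
- exact: (iF (@complex.Re R \o u) ru ruF).
- exact: (iF (@complex.Im R \o u) iu iuF).
Qed.

Hypothesis haar : is_haar mu.

Lemma cintegral_mull h u : polyfun u ->
  cintegral mu (fun g => u (h * g)%g) = cintegral mu u.
Proof.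
move=> pu; apply: (@cintegral_transform (fun g => h * g)%g) => //; last exact: polyfun_mull.
  by apply: so3_continuous_measurable; exact: so3_mull_continuous.
(* The preimage of [A] under translation by [h] is the image of [A] under translation by the
   inverse, which is the form in which invariance is given. *)
move=> A mA; rewrite -(haar h^-1%g mA).1; congr (mu _).
apply/seteqP; split => [g /= Ag|_ [x Ax <-]] /=; last by rewrite mulVKg.
by exists (h * g)%g => //; rewrite mulKg.
Qed.

Lemma cintegral_mulr h u : polyfun u ->
  cintegral mu (fun g => u (g * h)%g) = cintegral mu u.
Proof.
move=> pu; apply: (@cintegral_transform (fun g => g * h)%g) => //; last exact: polyfun_mulr.
  by apply: so3_continuous_measurable; exact: so3_mulr_continuous.
move=> A mA; rewrite -(haar h^-1%g mA).2; congr (mu _).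
apply/seteqP; split => [g /= Ag|_ [x Ax <-]] /=; last by rewrite mulgVK.
by exists (g * h)%g => //; rewrite mulgK.
Qed.

End Integration.

(** * Euler angles and definiteness of the inner product *)

Section EulerAngles.
Context {R : realType}.
Implicit Types (x y : R) (g h : SO3 R).

Lemma so3P g h : (forall i j, g i j = h i j) -> g = h.
Proof. by move=> gh; apply: val_inj; apply/matrixP. Qed.

Lemma Rz0 : Rz 0 = 1%g :> SO3 R.
Proof.
apply: so3P => i j; rewrite !mxE.
by case: i j => [[|[|[|//]]] ?] [[|[|[|//]]] ?] /=; rewrite ?cos0 ?sin0 ?oppr0.
Qed.

Lemma ord3P (i : 'I_3) : [\/ i = 0, i = 1 | i = 2%:R].
Proof.
case: i => [[|[|[|//]]] ?]; [apply: Or31|apply: Or32|apply: Or33]; exact: val_inj.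
Qed.

Lemma sum_ord3 (F : 'I_3 -> R) : \sum_i F i = F 0 + F 1 + F 2%:R.
Proof.
rewrite !big_ord_recl big_ord0 addr0 addrA.
by congr (_ + F _ + F _); exact: val_inj.
Qed.

Lemma det_mx33 (M : 'M[R]_3) : \det M =
  M 0 0 * (M 1 1 * M 2%:R 2%:R - M 1 2%:R * M 2%:R 1)
  - M 0 1 * (M 1 0 * M 2%:R 2%:R - M 1 2%:R * M 2%:R 0)
  + M 0 2%:R * (M 1 0 * M 2%:R 1 - M 1 1 * M 2%:R 0).
Proof.
pose f i j := M (inord i) (inord j).
have fE : M = \matrix_(i < 3, j < 3) f i j.
  by apply/matrixP => i j; rewrite mxE /f !inord_val.
rewrite fE (expand_det_row _ 0) !big_ord_recl big_ord0 /cofactor.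
rewrite !(expand_det_row _ 0) !big_ord_recl !big_ord0 /cofactor !det_mx11 !mxE /=.
rewrite /bump /=; ring.
Qed.

Lemma circle_param x y : x ^+ 2 + y ^+ 2 = 1 -> exists a, cos a = x /\ sin a = y.
Proof.
move=> xy; have x1 : -1 <= x <= 1.
  by rewrite -ler_norml -(@expr_le1 _ 2)// real_normK ?num_real// -xy lerDl sqr_ge0.
have sx : sin (acos x) = `|y|.
  by rewrite sin_acos// -xy addrAC subrr add0r sqrtr_sqr.
have [y0|y0] := leP 0 y.
  by exists (acos x); rewrite acosK ?in_itv//= sx ger0_norm.
by exists (- acos x); rewrite cosN sinN acosK ?in_itv//= sx ltr0_norm ?opprK.
Qed.

(** The third column of [g] is a unit vector with spherical coordinates [b] and [a]. Removing
    [Rz a * Ry b] leaves a rotation [h] that fixes the third basis vector, hence a rotation about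
    the z-axis. *)
Lemma euler_exists g : exists a b c, 0 <= b <= pi /\ g = Reuler a b c.
Proof.
have x1 : -1 <= g 2%:R 2%:R <= 1 by rewrite -ler_norml so3_entry_le1.
pose b := acos (g 2%:R 2%:R).
have hb : 0 <= b <= pi by rewrite acos_ge0// acos_lepi.
have cb : cos b = g 2%:R 2%:R by rewrite acosK// in_itv.
have col : g 0 2%:R ^+ 2 + g 1 2%:R ^+ 2 = sin b ^+ 2.
  have /matrixP/(_ 2%:R 2%:R) := so3_trmulmx g.
  rewrite !mxE !big_ord_recl big_ord0 !mxE /= mulr1n addr0 => e.
  rewrite sin2cos2 cb -e.
  have -> : lift ord0 ord0 = 1 :> 'I_3 by exact: val_inj.
  have -> : lift ord0 (lift ord0 ord0) = 2%:R :> 'I_3 by exact: val_inj.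
  ring.
have [a [a1 a2]] : exists a, g 0 2%:R = cos a * sin b /\ g 1 2%:R = sin a * sin b.
  (* At the poles the first two entries of the column vanish and any [a] works; 0 is taken. *)
  have [sb|sb] := eqVneq (sin b) 0.
    exists 0; move: col; rewrite sb expr0n mulr0 mulr0 /= => /eqP.
    by rewrite paddr_eq0 ?sqr_ge0// !sqrf_eq0 => /andP[/eqP -> /eqP ->].
  have [|a [ca sa]] := @circle_param (g 0 2%:R / sin b) (g 1 2%:R / sin b).
    by rewrite !expr_div_n -mulrDl col divff// sqrf_eq0.
  by exists a; rewrite ca sa !divfK.
pose P := (Rz a * Ry b)%g; pose h := (P^-1 * g)%g.
have Pcol k : g k 2%:R = P k 2%:R.
  have e : (P * Rz 0)%g = P by rewrite Rz0 mulg1.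
  have [_ _] := Reuler_entry a b 0; rewrite /Reuler -/P e => e0 e1 [_ _ e2].
  by case: (ord3P k) => ->; rewrite ?a1 ?a2 ?e0 ?e1 ?e2 ?cb.
have hcol k : h k 2%:R = (k == 2%:R)%:R.
  rewrite so3_mul_entry; under eq_bigr do rewrite Pcol.
  by rewrite -so3_mul_entry mulVg mxE.
have gh : g = (P * h)%g by rewrite /h mulVKg.
have /matrixP ho := so3_trmulmx h; have /matrixP ho' := so3_mulmxtr h.
clearbody h; have := so3_det h; rewrite det_mx33 !hcol /=.
have := ho 0 0; have := ho 1 1; have := ho' 2%:R 2%:R.
rewrite !mxE !sum_ord3 !mxE !hcol /= ?mulr1n.
set x := h 0 0; set y := h 0 1; set z := h 1 0; set t := h 1 1.
set p := h 2%:R 0; set q := h 2%:R 1 => e1 e2 e3 e4.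
have /andP[/eqP p0 /eqP q0] : (p == 0) && (q == 0).
  rewrite -[p == 0]sqrf_eq0 -[q == 0]sqrf_eq0 -paddr_eq0 ?sqr_ge0//; apply/eqP; lra.
rewrite p0 q0 in e1 e2 e3 e4.
(* The squares of [x - t] and [y + z] add up to x^2+y^2+z^2+t^2 - 2(xt - yz), which is 2 - 2 because
   the columns are unit vectors and the determinant is 1. *)
have /andP[/eqP xt /eqP yz] : (x - t == 0) && (y + z == 0).
  rewrite -[x - t == 0]sqrf_eq0 -[_ + _ == 0]sqrf_eq0 -paddr_eq0 ?sqr_ge0//; apply/eqP; lra.
have [|c [cc sc]] := @circle_param x z; first by lra.
exists a, b, c; split=> //; rewrite gh; congr (_ * _)%g; apply: so3P => i j.
have tx : t = x by lra.
have yz' : y = - z by lra.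
by case: (ord3P i) => ->; case: (ord3P j) => ->; rewrite ?hcol /= !mxE /= ?cc ?sc.
Qed.

End EulerAngles.

Section Definiteness.
Context {R : realType}.
Implicit Types (g h : SO3 R) (u : SO3 R -> R[i]).

Lemma Rz_entry_continuous i j : continuous (fun t : R => Rz t i j).
Proof.
under eq_fun do rewrite !mxE.
case: i j => [[|[|[|//]]] ?] [[|[|[|//]]] ?] /=;
  do ?[exact: continuous_cos|exact: continuous_sin|by move=> x; exact: cvg_cst].
by move=> x; apply: cvgN; exact: continuous_sin.
Qed.

Lemma Ry_entry_continuous i j : continuous (fun t : R => Ry t i j).
Proof.
under eq_fun do rewrite !mxE.
case: i j => [[|[|[|//]]] ?] [[|[|[|//]]] ?] /=;
  do ?[exact: continuous_cos|exact: continuous_sin|by move=> x; exact: cvg_cst].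
by move=> x; apply: cvgN; exact: continuous_sin.
Qed.

Lemma continuous_eq0_rat (F : R -> R) : continuous F ->
  (forall q : rat, F (ratr q) = 0) -> forall x, F x = 0.
Proof.
move=> /continuousP cF F0 x; apply/eqP; apply/negPn/negP => Fx.
have oA : open (F @^-1` [set y | y != 0]).
  by apply: cF; exact: open_neq.
have [|y [/= Fy [q _ qy]]] := dense_rat _ oA; first by exists x.
by move: Fy; rewrite -qy F0 eqxx.
Qed.

(** The angles are freed from the rationals one at a time, in the order [c], [b], [a]: with the
    other two factors absorbed into translations of [u], the value depends continuously on a single
    angle. *)
Lemma polyfun_eq0_rat u : polyfun u ->
  (forall p q r : rat, complex.Re (u (Reuler (ratr p) (ratr q) (ratr r))) = 0) ->
  forall a b c, complex.Re (u (Reuler a b c)) = 0.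
Proof.
move=> pu u0.
have cz x y := (polyfun_continuous Rz_entry_continuous (polyfun_mull x (polyfun_mulr y pu))).1.
have cy x y := (polyfun_continuous Ry_entry_continuous (polyfun_mull x (polyfun_mulr y pu))).1.
have u1 p q c : complex.Re (u (Reuler (ratr p) (ratr q) c)) = 0.
  have := continuous_eq0_rat (cz (Rz (ratr p) * Ry (ratr q))%g 1%g).
  by move/(_ _ c); rewrite mulg1; apply => r; rewrite mulg1; exact: u0.
have u2 p b c : complex.Re (u (Reuler (ratr p) b c)) = 0.
  have := continuous_eq0_rat (cy (Rz (ratr p)) (Rz c)).
  by move/(_ _ b); apply => q; exact: u1.
move=> a b c; have := continuous_eq0_rat (cz 1%g (Ry b * Rz c)%g).
move/(_ _ a); rewrite mul1g mulgA; apply => p.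
by rewrite mul1g mulgA; exact: u2.
Qed.

Lemma probability_setT_not_negligible (mu : probability (SO3 R) R) :
  ~ mu.-negligible [set: SO3 R].
Proof.
move=> [A [mA muA0 TA]].
have AT : A = setT by apply/seteqP; split.
have := @probability_setT _ _ _ mu; rewrite -AT => mA1.
by have := etrans (esym mA1) muA0 => /eqP; rewrite onee_eq0.
Qed.

Lemma inner_prod_definite (mu : probability (SO3 R) R) u : is_haar mu ->
  polyfun u -> inner_prod mu u u = 0 -> forall g, u g = 0.
Proof.
move=> haar pu; rewrite /inner_prod; set w := (fun g => u g * _) => w0.
have pw : polyfun w by apply: polyfunM => //; exact: polyfun_conj.
have Rew g : complex.Re (w g) = complex.Re (u g) ^+ 2 + complex.Im (u g) ^+ 2.
  by rewrite /w; case: (u g) => x y /=; ring.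
have Rew_ge0 g : 0 <= complex.Re (w g) by rewrite Rew addr_ge0 ?sqr_ge0.
pose h (p : rat * rat * rat) : SO3 R :=
  Reuler (ratr p.1.1) (ratr p.1.2) (ratr p.2).
(* By left invariance the translate of [w] by [h p] also has integral 0; its real part is
   nonnegative and so vanishes almost everywhere. *)
have ae0 p : mu.-negligible [set g | complex.Re (w (h p * g)%g) != 0].
  have pwh := polyfun_mull (h p) pw.
  have := cintegral_mull haar (h p) pw; rewrite w0 /cintegral => -[e _].
  have [ir _] := polyfun_integrable mu pwh.
  have /integrableP[mr _] := ir.
  have : ae_eq mu setT (EFin \o (fun g => complex.Re (w (h p * g)%g))) (cst 0%E).
    apply/ae_eq_integral_abs => //.
    under eq_integral => g _ do rewrite /= ger0_norm//.
    rewrite -[LHS]fineK; first by rewrite [fine _]e.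
    exact: (integrable_fin_num measurableT ir).
  apply: negligibleS => g /= /eqP gn0 /(_ I) [].
  exact.
(* The rational triples are enumerated by [unpickle] so that the exceptional sets form a sequence;
   integers that code no triple receive the empty set. *)
pose F n := if unpickle n is Some p then [set g | complex.Re (w (h p * g)%g) != 0]
            else set0.
have nF : mu.-negligible (\bigcup_n F n).
  apply: negligible_bigcup => n; rewrite /F; case: unpickle => [p|]; first exact: ae0.
  exact: negligible_set0.
have [g0 hg0] : exists g0, ~ (\bigcup_n F n) g0.
  apply/existsNP => all; apply: (@probability_setT_not_negligible mu).
  by apply: negligibleS nF => g _; exact: all.
have wh0 p : complex.Re (w (h p * g0)%g) = 0.
  apply/eqP/negPn/negP => n0; apply: hg0; exists (pickle p); first exact: I.
  rewrite /F pickleK; exact: n0.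
move=> g.
(* Every [g] is [(g * g0^-1) * g0], so the Euler angles of the first factor can be approximated by
   rational ones. *)
have := polyfun_eq0_rat (polyfun_mulr g0 pw) (fun p q r => wh0 (p, q, r)).
have [a [b [c [_ e]]]] := euler_exists (g * g0^-1)%g.
move/(_ a b c); rewrite -e mulgVK Rew => /eqP.
rewrite paddr_eq0 ?sqr_ge0// !sqrf_eq0.
by case: (u g) => x y /= /andP[/eqP -> /eqP ->].
Qed.

End Definiteness.

(** * Translations of the Wigner-D functions *)

Section EulerTranslations.
Context {R : realType}.
Implicit Types (a b c t : R) (g : SO3 R) (n : nat) (k l : int).

Lemma Rz_mul a b : (Rz a * Rz b)%g = Rz (a + b) :> SO3 R.
Proof.
apply: so3P => i j; rewrite so3_mul_entry sum_ord3 !mxE.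
by case: i j => [[|[|[|//]]] ?] [[|[|[|//]]] ?] /=; rewrite ?cosD ?sinD; ring.
Qed.

Lemma Ry0 : Ry 0 = 1%g :> SO3 R.
Proof.
apply: so3P => i j; rewrite !mxE.
by case: i j => [[|[|[|//]]] ?] [[|[|[|//]]] ?] /=; rewrite ?cos0 ?sin0 ?oppr0.
Qed.

Lemma Rz_Reuler t a b c : (Rz t * Reuler a b c)%g = Reuler (t + a) b c.
Proof. by rewrite /Reuler !mulgA Rz_mul. Qed.

Lemma Reuler_Rz t a b c : (Reuler a b c * Rz t)%g = Reuler a b (c + t).
Proof. by rewrite /Reuler -!mulgA Rz_mul. Qed.

Lemma Rypi_Rz a : (Ry pi * Rz a)%g = (Rz (- a) * Ry pi)%g :> SO3 R.
Proof.
apply: so3P => i j; rewrite !so3_mul_entry !sum_ord3 !mxE.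
by case: i j => [[|[|[|//]]] ?] [[|[|[|//]]] ?] /=;
  rewrite ?cosN ?sinN ?cospi ?sinpi; ring.
Qed.

(** The angle pi + b leaves the interval [0, pi] on which [wignerDE] evaluates a Wigner-D function,
    whereas pi - b stays in it. *)
Lemma Ry_piD b : (Ry pi * Ry b)%g = (Rz pi * Ry (pi - b) * Rz pi)%g :> SO3 R.
Proof.
apply: so3P => i j; rewrite !so3_mul_entry !sum_ord3 !so3_mul_entry !sum_ord3 !mxE.
by case: i j => [[|[|[|//]]] ?] [[|[|[|//]]] ?] /=;
  rewrite ?cosB ?sinB ?cospi ?sinpi; ring.
Qed.

Lemma Ry_pi_comm b : (Ry b * Ry pi)%g = (Ry pi * Ry b)%g :> SO3 R.
Proof.
apply: so3P => i j; rewrite !so3_mul_entry !sum_ord3 !mxE.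
by case: i j => [[|[|[|//]]] ?] [[|[|[|//]]] ?] /=; ring.
Qed.

Lemma Ry_Reuler a b c : (Ry pi * Reuler a b c)%g = Reuler (pi - a) (pi - b) (pi + c).
Proof.
rewrite /Reuler !mulgA Rypi_Rz -(mulgA (Rz (- a))) Ry_piD !mulgA Rz_mul.
by rewrite -(mulgA _ (Rz pi)) Rz_mul (addrC (- a)).
Qed.

Lemma Reuler_Ry a b c : (Reuler a b c * Ry pi)%g = Reuler (pi + a) (pi - b) (pi - c).
Proof.
have e : (Rz c * Ry pi)%g = (Ry pi * Rz (- c))%g :> SO3 R by rewrite Rypi_Rz opprK.
rewrite /Reuler -!mulgA e !mulgA -(mulgA (Rz a)) Ry_pi_comm Ry_piD !mulgA Rz_mul.
by rewrite -(mulgA _ (Rz pi)) Rz_mul (addrC a).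
Qed.

Lemma expipi : expi pi = -1 :> R[i].
Proof. by rewrite /expi cospi sinpi; apply/eqP; rewrite eq_complex /= oppr0 !eqxx. Qed.

Lemma realC_expN1z (m : int) : ((-1) ^ m : R)%:C%C = (-1) ^ m :> R[i].
Proof.
by case: m => m; rewrite ?NegzE -?exprnN ?fmorphV rmorphXn rmorphN1.
Qed.


Lemma wignerD_Rz_mul n k l t g :
  wignerD n k l (Rz t * g)%g = expi (- (k%:~R * t)) * wignerD n k l g.
Proof.
have [a [b [c [hb ->]]]] := euler_exists g.
rewrite Rz_Reuler !wignerDE// /wignerD_angles mulrDr opprD expiD; ring.
Qed.

Lemma wignerD_mul_Rz n k l t g :
  wignerD n k l (g * Rz t)%g = expi (- (l%:~R * t)) * wignerD n k l g.
Proof.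
have [a [b [c [hb ->]]]] := euler_exists g.
rewrite Reuler_Rz !wignerDE// /wignerD_angles mulrDr opprD expiD; ring.
Qed.

Lemma pi_sub_itv b : 0 <= b <= pi -> 0 <= pi - b <= pi.
Proof. by move=> /andP[b0 bpi]; rewrite subr_ge0 bpi lerBlDr lerDl. Qed.

Lemma expi_mulz_pi k : expi (- (k%:~R * pi)) = (-1) ^ k :> R[i].
Proof.
rewrite -mulNr -mulrNz expi_mulz expipi; apply: exprN1_parity; lia.
Qed.

(** The shifts of the outer angles by pi give (-1)^k (-1)^l, the reversal of the first angle turns
    [k] into [- k], and replacing the polar angle by pi - b gives (-1)^(n+l) through [wignerdN]. *)
Lemma wignerD_Ry_mul n k l g : (`|k| <= n)%N -> (`|l| <= n)%N ->
  wignerD n k l (Ry pi * g)%g = (-1) ^ (n%:Z + k) * wignerD n (- k) l g.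
Proof.
move=> kn ln; have [a [b [c [hb ->]]]] := euler_exists g.
rewrite Ry_Reuler !wignerDE ?pi_sub_itv// /wignerD_angles.
have -> : cos (pi - b) = - cos b by rewrite cosB cospi sinpi; ring.
rewrite wignerdN// rmorphM /= realC_expN1z (mulrDr k%:~R pi) (mulrDr l%:~R pi).
rewrite (opprD (k%:~R * pi)) (opprD (l%:~R * pi)) !expiD !expi_mulz_pi.
rewrite mulrN opprK mulrNz mulNr opprK.
have -> : (-1) ^ (n%:Z + k) = (-1) ^ k * (-1) ^ l * (-1) ^ (n%:Z + l) :> R[i].
  rewrite -!expfzDr ?oppr_eq0 ?oner_eq0//; apply: exprN1_parity; lia.
ring.
Qed.

Lemma wignerD_mul_Ry n k l g : (`|k| <= n)%N -> (`|l| <= n)%N ->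
  wignerD n k l (g * Ry pi)%g = (-1) ^ (n%:Z + l) * wignerD n k (- l) g.
Proof.
move=> kn ln; have [a [b [c [hb ->]]]] := euler_exists g.
rewrite Reuler_Ry !wignerDE ?pi_sub_itv// /wignerD_angles.
have -> : cos (pi - b) = - cos b by rewrite cosB cospi sinpi; ring.
rewrite wignerdN_r// rmorphM /= realC_expN1z (mulrDr k%:~R pi) (mulrDr l%:~R pi).
rewrite (opprD (k%:~R * pi)) (opprD (l%:~R * pi)) !expiD !expi_mulz_pi.
rewrite mulrN opprK mulrNz mulNr opprK.
have -> : (-1) ^ (n%:Z + l) = (-1) ^ k * (-1) ^ l * (-1) ^ (n%:Z + k) :> R[i].
  rewrite -!expfzDr ?oppr_eq0 ?oner_eq0//; apply: exprN1_parity; lia.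
ring.
Qed.

End EulerTranslations.

(** * Wigner-D functions are polynomial *)

Section WignerDPolynomial.
Context {R : realType}.
Implicit Types (a b c t : R) (g : SO3 R) (n : nat) (k l : int).
Implicit Types (phi psi : R -> R -> R -> R[i]).

(** Speaking of functions of the angles gives room for half-angle factors that do not descend to
    SO(3), inside products that do. *)
Definition euler_polyfun phi := exists2 P : SO3 R -> R[i], polyfun P &
  forall a b c, 0 <= b <= pi -> P (Reuler a b c) = phi a b c.

Lemma euler_polyfun_ext phi psi :
  (forall a b c, 0 <= b <= pi -> phi a b c = psi a b c) ->
  euler_polyfun phi -> euler_polyfun psi.
Proof. by move=> e [P pP Pphi]; exists P => // a b c hb; rewrite Pphi// e. Qed.

Lemma euler_polyfunM phi psi : euler_polyfun phi -> euler_polyfun psi ->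
  euler_polyfun (fun a b c => phi a b c * psi a b c).
Proof.
move=> [P pP Pphi] [Q pQ Qpsi]; exists (fun g => P g * Q g); first exact: polyfunM.
by move=> a b c hb; rewrite Pphi// Qpsi.
Qed.

Lemma euler_polyfunX phi m : euler_polyfun phi ->
  euler_polyfun (fun a b c => phi a b c ^+ m).
Proof.
move=> [P pP Pphi]; exists (fun g => P g ^+ m); first exact: polyfunX.
by move=> a b c hb; rewrite Pphi.
Qed.

Lemma euler_polyfun_conj phi : euler_polyfun phi ->
  euler_polyfun (fun a b c => (phi a b c)^*%C).
Proof.
move=> [P pP Pphi]; exists (fun g => (P g)^*%C); first exact: polyfun_conj.
by move=> a b c hb; rewrite Pphi.
Qed.

Lemma euler_polyfun_cst z : euler_polyfun (fun _ _ _ => z).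
Proof. by exists (fun=> z) => //; exact: polyfun_cst. Qed.

Lemma euler_polyfun_horner (p : {poly R}) :
  euler_polyfun (fun _ b _ => (p.[cos b])%:C%C).
Proof.
exists (fun g => \sum_(i <- index_enum 'I_(size p)) (p`_i)%:C%C * (g 2%:R 2%:R)%:C%C ^+ i).
  by apply: polyfun_sum => i _; apply/polyfunZ/polyfunX; exact: polyfun_entry.
move=> a b c _; have [_ _ _ _ [_ _ ->]] := Reuler_entry a b c.
by rewrite horner_coef rmorph_sum; apply: eq_bigr => i _; rewrite rmorphM rmorphXn.
Qed.

(* Entries of an SU(2) matrix over R_z(a)R_y(b)R_z(c); only their products of
   even degree descend to functions on SO(3). *)
Definition spinA a b c : R[i] := (Num.sqrt ((1 + cos b) / 2))%:C%C * expi (- ((a + c) / 2)).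
Definition spinB a b c : R[i] := (Num.sqrt ((1 - cos b) / 2))%:C%C * expi (- ((a - c) / 2)).

Lemma expi_sqr t : expi (- (t / 2)) ^+ 2 = expi (- t) :> R[i].
Proof. by rewrite expr2 -expiD; congr expi; lra. Qed.

Lemma half_cos_ge0 b : 0 <= (1 + cos b) / 2 /\ 0 <= (1 - cos b) / 2.
Proof.
by have := cos_geN1 b; have := cos_le1 b => h1 h2; split; lra.
Qed.

(** On [0, pi] the sine is nonnegative, so the root of (sin b / 2)^2 is sin b / 2 itself. *)
Lemma sqrt_half_cos b : 0 <= b <= pi ->
  (Num.sqrt ((1 + cos b) / 2))%:C%C * (Num.sqrt ((1 - cos b) / 2))%:C%C =
  (sin b / 2)%:C%C :> R[i].
Proof.
move=> hb; have [hp hm] := half_cos_ge0 b; rewrite -rmorphM /= -sqrtrM//.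
have -> : (1 + cos b) / 2 * ((1 - cos b) / 2) = (sin b / 2) ^+ 2.
  by rewrite expr_div_n sin2cos2; field.
by rewrite sqrtr_sqr ger0_norm// divr_ge0// sin_ge0_pi.
Qed.

Lemma Reuler_entry_col1 a b c : let g := Reuler a b c in
  g 0 1 = - (cos a * cos b * sin c) - sin a * cos c /\
  g 1 1 = - (sin a * cos b * sin c) + cos a * cos c.
Proof.
by rewrite /=; split; rewrite !(mxE, big_ord_recl, big_ord0) /=; ring.
Qed.

Lemma polyfun_lincomb (z w : R[i]) (u v : SO3 R -> R[i]) :
  polyfun u -> polyfun v -> polyfun (fun g => z * u g + w * v g).
Proof. by move=> pu pv; apply: polyfunD; exact: polyfunZ. Qed.

Lemma spinA_sqr : euler_polyfun (fun a b c => spinA a b c ^+ 2).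
Proof.
(* Here [g 0 0 + g 1 1] is (1 + cos b) cos(a+c) and [g 1 0 - g 0 1] is (1 + cos b) sin(a+c). *)
exists (fun g => (2^-1)%:C%C * ((g 0 0)%:C%C + (g 1 1)%:C%C) +
                 (0 -i* 2^-1)%C * ((g 1 0)%:C%C + (-1) * (g 0 1)%:C%C)).
  apply: polyfun_lincomb; apply: polyfunD; try exact: polyfun_entry.
  by apply: polyfunZ; exact: polyfun_entry.
move=> a b c _; have [-> -> _ _ _] := Reuler_entry a b c.
have [-> ->] := Reuler_entry_col1 a b c.
rewrite /spinA exprMn expi_sqr -rmorphXn sqr_sqrtr; last exact: (half_cos_ge0 b).1.
rewrite /expi cosN sinN cosD sinD; apply/eqP; rewrite eq_complex /=.
by apply/andP; split; apply/eqP; field.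
Qed.

Lemma spinB_sqr : euler_polyfun (fun a b c => spinB a b c ^+ 2).
Proof.
(* Here [g 0 0 - g 1 1] is -(1 - cos b) cos(a-c) and [g 1 0 + g 0 1] is -(1 - cos b) sin(a-c). *)
exists (fun g => (- 2^-1)%:C%C * ((g 0 0)%:C%C + (-1) * (g 1 1)%:C%C) +
                 (0 +i* 2^-1)%C * ((g 1 0)%:C%C + (g 0 1)%:C%C)).
  apply: polyfun_lincomb; apply: polyfunD; try exact: polyfun_entry.
  by apply: polyfunZ; exact: polyfun_entry.
move=> a b c _; have [-> -> _ _ _] := Reuler_entry a b c.
have [-> ->] := Reuler_entry_col1 a b c.
rewrite /spinB exprMn expi_sqr -rmorphXn sqr_sqrtr; last exact: (half_cos_ge0 b).2.
rewrite /expi cosN sinN cosB sinB; apply/eqP; rewrite eq_complex /=.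
by apply/andP; split; apply/eqP; field.
Qed.

Lemma spinAB : euler_polyfun (fun a b c => spinA a b c * spinB a b c).
Proof.
(* The half angles combine to sin b e^(-ia) / 2, which is read off the third column. *)
exists (fun g => (2^-1)%:C%C * (g 0 2%:R)%:C%C + (0 -i* 2^-1)%C * (g 1 2%:R)%:C%C).
  by apply: polyfun_lincomb; exact: polyfun_entry.
move=> a b c hb; have [_ _ -> -> _] := Reuler_entry a b c.
rewrite /spinA /spinB mulrACA sqrt_half_cos// -expiD.
have -> : - ((a + c) / 2) + - ((a - c) / 2) = - a by lra.
rewrite /expi cosN sinN; apply/eqP; rewrite eq_complex /=.
by apply/andP; split; apply/eqP; field.
Qed.

Lemma conjcM (x y : R[i]) : (x * y)^*%C = x^*%C * y^*%C.
Proof. exact: (rmorphM conjc). Qed.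

Lemma conj_expi t : (expi t)^*%C = expi (- t) :> R[i].
Proof. by rewrite /expi cosN sinN. Qed.

Lemma spinABc : euler_polyfun (fun a b c => spinA a b c * (spinB a b c)^*%C).
Proof.
(* Conjugating the second factor leaves sin b e^(-ic) / 2 instead, which is read off the third
   row. *)
exists (fun g => (- 2^-1)%:C%C * (g 2%:R 0)%:C%C + (0 -i* 2^-1)%C * (g 2%:R 1)%:C%C).
  by apply: polyfun_lincomb; exact: polyfun_entry.
move=> a b c hb; have [_ _ _ _ [-> -> _]] := Reuler_entry a b c.
rewrite /spinA /spinB conjcM conj_expi conjc_real mulrACA sqrt_half_cos// -expiD.
have -> : - ((a + c) / 2) + - - ((a - c) / 2) = - c by lra.
rewrite /expi cosN sinN; apply/eqP; rewrite eq_complex /=.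
by apply/andP; split; apply/eqP; field.
Qed.

(** Equal parity lets the product be split into squares of [phi], squares of [psi] and at most one
    factor [phi * psi]. *)
Lemma euler_polyfun_parity phi psi p q : odd p = odd q ->
  euler_polyfun (fun a b c => phi a b c ^+ 2) ->
  euler_polyfun (fun a b c => psi a b c ^+ 2) ->
  euler_polyfun (fun a b c => phi a b c * psi a b c) ->
  euler_polyfun (fun a b c => phi a b c ^+ p * psi a b c ^+ q).
Proof.
move=> pq phi2 psi2 phipsi.
apply: (@euler_polyfun_ext (fun a b c => (phi a b c ^+ 2) ^+ p./2 * (psi a b c ^+ 2) ^+ q./2
    * (phi a b c * psi a b c) ^+ odd p)).
  move=> a b c _; rewrite -[in RHS](odd_double_half p) -[in RHS](odd_double_half q) -pq.
  rewrite !exprD -!mul2n !exprM (mulrC (phi a b c ^+ _)) (mulrC (psi a b c ^+ _)).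
  by rewrite [RHS]mulrACA -exprMn.
by do ?apply: euler_polyfunM; exact: euler_polyfunX.
Qed.

Definition conj_if (s : bool) (z : R[i]) := if s then z^*%C else z.

Lemma spin_polyfun (s t : bool) p q : odd p = odd q ->
  euler_polyfun (fun a b c => conj_if s (spinA a b c) ^+ p * conj_if t (spinB a b c) ^+ q).
Proof.
move=> pq; apply: euler_polyfun_parity => //.
- case: s; last exact: spinA_sqr.
  by under eq_fun do under eq_fun do under eq_fun do rewrite -rmorphXn;
    exact/euler_polyfun_conj/spinA_sqr.
- case: t; last exact: spinB_sqr.
  by apply: euler_polyfun_ext (euler_polyfun_conj spinB_sqr) => a b c _; rewrite rmorphXn.
- case: s; case: t; [|..|exact: spinAB].
  + by apply: euler_polyfun_ext (euler_polyfun_conj spinAB) => a b c _; exact: conjcM.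
  + apply: euler_polyfun_ext (euler_polyfun_conj spinABc) => a b c _.
    by rewrite -[spinB a b c in RHS]conjcK; exact: conjcM.
  + exact: spinABc.
Qed.

Lemma real_expi_pow (x t : R) (m : int) :
  (x%:C%C ^+ absz m) * expi t ^ m = conj_if (m < 0) (x%:C%C * expi t) ^+ absz m.
Proof.
rewrite /conj_if; case: ltP => m0.
  rewrite conjcM conj_expi conjc_real exprMn expiN exprVn exprnN.
  by congr (_ * _ ^ _); lia.
by rewrite exprMn (exprnP (expi t)); congr (_ * _ ^ _); lia.
Qed.

(** Since ka + lc = (k+l)(a+c)/2 + (k-l)(a-c)/2, the phases join the half-integer powers of (1 + cos
    b)/2 and (1 - cos b)/2 to form powers of [spinA] and [spinB] with exponents |k+l| and |k-l|,
    conjugated when k+l or k-l is negative. These exponents have equal parity, and the remaining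
    factor is a polynomial in cos b. *)
Lemma wignerD_angles_polyfun n k l : euler_polyfun (wignerD_angles n k l).
Proof.
pose s := (n - maxn (absz k) (absz l))%N.
pose J : {poly R} := jacobi s (absz (k - l)%R) (absz (k + l)%R).
pose C : R := (-1) ^ (if l < k then k + l else 0) *
  Num.sqrt 'C(2 * n - s, s + absz (k - l)%R)%:R / Num.sqrt 'C(s + absz (k + l)%R, absz (k + l)%R)%:R.
apply: (@euler_polyfun_ext (fun a b c => (Num.sqrt (2 * n + 1)%:R * C)%:C%C * (J.[cos b])%:C%C *
  (conj_if (k + l < 0) (spinA a b c) ^+ absz (k + l)%R *
   conj_if (k - l < 0) (spinB a b c) ^+ absz (k - l)%R))); last first.
  apply: euler_polyfunM; last by apply: spin_polyfun; lia.
  apply: euler_polyfunM; first exact: euler_polyfun_cst.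
  exact: euler_polyfun_horner.
move=> a b c hb; rewrite -!real_expi_pow /wignerD_angles /wignerd -/s -/J -/C.
have [hp hm] := half_cos_ge0 b.
have powR_half (x : R) m : 0 <= x -> x `^ (m%:R / 2) = Num.sqrt x ^+ m.
  by move=> x0; rewrite mulrC powRrM powR12_sqrt// powR_mulrn// sqrtr_ge0.
rewrite !powR_half// -!expi_mulz !rmorphM /= !rmorphXn /=.
have -> : expi (- (k%:~R * a)) = expi ((k + l)%:~R * - ((a + c) / 2)) *
    expi ((k - l)%:~R * - ((a - c) / 2)) * expi (l%:~R * c) :> R[i].
  by rewrite -!expiD; congr expi; rewrite intrD intrB; field.
have := mulfV (expi_neq0 (l%:~R * c)); rewrite -expiN.
set e1 := expi (l%:~R * c); set e2 := expi (- (l%:~R * c)) => e12.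
set x := expi _; set y := expi _.
ring: e12.
Qed.

Lemma wignerD_polyfun n k l : polyfun (wignerD n k l : SO3 R -> R[i]).
Proof.
have [P pP Pw] := wignerD_angles_polyfun n k l.
suff -> : wignerD n k l = P by [].
apply/funext => g; have [a [b [c [hb ->]]]] := euler_exists g.
by rewrite wignerDE// Pw.
Qed.

End WignerDPolynomial.

(** * The Wigner transform and the harmonic coefficients *)

Section WignerTransform.
Context {R : realType}.
Implicit Types (n N : nat) (k j l : int) (fh : nat -> int -> int -> R[i]).

Lemma wignerd_opp_r0 n j k : (`|j| <= n)%N -> (`|k| <= n)%N ->
  wignerd n j (- k) 0 = (-1) ^ (n%:Z + j) * wignerd n j k 0 :> R.
Proof. by move=> jn kn; rewrite -{1}oppr0 wignerdN_r ?abszN// opprK. Qed.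

(* The system is triangular: for j = m the sum starts at n = m, and d_m^{m,k}(0) <> 0. *)
Lemma wigner_system_eq0 N k l (x : nat -> R[i]) :
  (forall j, j \in zball N ->
    \sum_(maxn (absz k) (maxn (absz l) (absz j)) <= n < N.+1)
      (Num.sqrt (2 * n + 1)%:R * wignerd n j k 0 * wignerd n j l 0)%:C%C * x n = 0) ->
  forall n, (absz k <= n)%N -> (absz l <= n)%N -> (n <= N)%N -> x n = 0.
Proof.
move=> sys0 n; have [m] := ubnP (N - n)%N; elim: m n => // m IH n nm kn ln nN.
have nball : n%:Z \in zball N by rewrite mem_zball.
have := sys0 n nball.
have -> : maxn (absz k) (maxn (absz l) (absz n%:Z)) = n by lia.
rewrite big_ltn// big_nat big1 => [|i /andP[ni iN]]; last first.
  by rewrite [x i]IH ?mulr0//; lia.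
rewrite addr0 => /eqP; rewrite mulf_eq0 fmorph_eq0 => /orP[|/eqP//]; apply: contraTeq => _.
apply: mulf_neq0; last exact: wignerd_diag_neq0.
apply: mulf_neq0; last exact: wignerd_diag_neq0.
by rewrite sqrtr_eq0 -ltNge ltr0n addn1.
Qed.

(** The transform couples only coefficients with the same [k] and [l], so injectivity can be stated
    one pair at a time, with the negated indices at which it reads its argument. It follows by
    solving the triangular system for the difference. *)
Lemma wigner_transformP N fh1 fh2 k l :
  (forall n, Jset N n (- k) (- l) -> fh1 n (- k) (- l) = fh2 n (- k) (- l)) <->
  (forall j, j \in zball N ->
    wigner_transform N fh1 k j l = wigner_transform N fh2 k j l).
Proof.
split=> [e j _|e n /and3P[nN kn ln]].
  congr (_ * _); apply: eq_big_nat => n /andP[nM nN]; rewrite e//.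
  by rewrite /Jset !abszN; lia.
rewrite !abszN in kn ln.
apply/eqP; rewrite -subr_eq0; apply/eqP.
apply: (@wigner_system_eq0 N k l (fun n => fh1 n (- k) (- l) - fh2 n (- k) (- l))) => // j jN.
have i0 : 'i%C ^ (k - l) != 0 :> R[i].
  by rewrite expfz_neq0// eq_complex /= eqxx oner_eq0.
have /(mulfI i0)/eqP := e j jN; rewrite -subr_eq0 -sumrB => /eqP e0.
by rewrite -[RHS]e0; apply: eq_bigr => i _; rewrite mulrBr.
Qed.

Lemma i_exprz_even k : 'i%C ^ (k + k) = (-1) ^ k :> R[i].
Proof.
rewrite expfzDr; last by rewrite eq_complex /= eqxx oner_eq0.
by rewrite -expfzMl -expr2 sqr_i.
Qed.

(** Replacing [k] by [- k] changes the power of i by (-1)^k and d_n^{j,k}(0) by (-1)^(n+j). Together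
    with the sign on the coefficients, the dependence on [n] and [k] cancels and (-1)^j remains. *)
Lemma wigner_transform_oppl N fh k j l :
  wigner_transform N (fun n k l => (-1) ^ (n%:Z + k) * fh n (- k) l) k j l =
  (-1) ^ j * wigner_transform N fh (- k) j l.
Proof.
rewrite /wigner_transform abszN opprK mulrCA.
have -> : 'i%C ^ (k - l) = 'i%C ^ (- k - l) * (-1) ^ k :> R[i].
  rewrite -i_exprz_even -expfzDr; last by rewrite eq_complex /= eqxx oner_eq0.
  by congr (_ ^ _); lia.
rewrite -mulrA; congr (_ * _); rewrite !mulr_sumr; apply: eq_big_nat => n /andP[nM nN].
rewrite (wignerd_opp_r0 (j := j) (k := k)); [|lia..].
move: (wignerd n j k 0) (wignerd n j l 0) => d1 d2.
rewrite !rmorphM /= realC_expN1z.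
have -> : (-1) ^ (n%:Z - k) = (-1) ^ k * (-1) ^ j * (-1) ^ (n%:Z + j) :> R[i].
  rewrite -!expfzDr ?oppr_eq0 ?oner_eq0//; apply: exprN1_parity; lia.
have kk : (-1) ^ k * (-1) ^ k = 1 :> R[i].
  rewrite -expfzDr ?oppr_eq0 ?oner_eq0//; apply: (@exprN1_parity _ _ 0); lia.
move: kk; move: ((-1) ^ k) ((-1) ^ j) ((-1) ^ (n%:Z + j)) => ek ej enj kk.
by rewrite -[RHS]mul1r -kk; ring.
Qed.

Lemma wigner_transform_oppr N fh k j l :
  wigner_transform N (fun n k l => (-1) ^ (n%:Z + l) * fh n k (- l)) k j l =
  (-1) ^ j * wigner_transform N fh k j (- l).
Proof.
rewrite /wigner_transform abszN !opprK mulrCA.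
have -> : 'i%C ^ (k - l) = 'i%C ^ (k + l) * (-1) ^ l :> R[i].
  have -> : (-1) ^ l = (-1) ^ (- l) :> R[i] by apply: exprN1_parity; lia.
  rewrite -i_exprz_even -expfzDr; last by rewrite eq_complex /= eqxx oner_eq0.
  by congr (_ ^ _); lia.
rewrite -mulrA; congr (_ * _); rewrite !mulr_sumr; apply: eq_big_nat => n /andP[nM nN].
rewrite (wignerd_opp_r0 (j := j) (k := l)); [|lia..].
move: (wignerd n j k 0) (wignerd n j l 0) => d1 d2.
rewrite !rmorphM /= realC_expN1z.
have -> : (-1) ^ (n%:Z - l) = (-1) ^ l * (-1) ^ j * (-1) ^ (n%:Z + j) :> R[i].
  rewrite -!expfzDr ?oppr_eq0 ?oner_eq0//; apply: exprN1_parity; lia.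
have ll : (-1) ^ l * (-1) ^ l = 1 :> R[i].
  rewrite -expfzDr ?oppr_eq0 ?oner_eq0//; apply: (@exprN1_parity _ _ 0); lia.
move: ll; move: ((-1) ^ l) ((-1) ^ j) ((-1) ^ (n%:Z + j)) => el ej enj ll.
by rewrite -[RHS]mul1r -ll; ring.
Qed.

End WignerTransform.

(** * Orthogonality and the effect of translations on harmonic coefficients *)

Section HarmonicCoefficients.
Context {R : realType} (mu : probability (SO3 R) R).
Implicit Types (f u v : SO3 R -> R[i]) (N n : nat) (k l : int) (t : R).

Lemma inner_prodDr u v w : polyfun u -> polyfun v -> polyfun w ->
  inner_prod mu u (fun g => v g + w g) = inner_prod mu u v + inner_prod mu u w.
Proof.
move=> pu pv pw; rewrite /inner_prod -cintegralD; last 2 first.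
- by apply: polyfunM => //; exact: polyfun_conj.
- by apply: polyfunM => //; exact: polyfun_conj.
by congr cintegral; apply/funext => g; rewrite rmorphD mulrDr.
Qed.

Lemma inner_prodZr c u v : polyfun u -> polyfun v ->
  inner_prod mu u (fun g => c * v g) = c^*%C * inner_prod mu u v.
Proof.
move=> pu pv; rewrite /inner_prod -cintegralZ; last first.
  by apply: polyfunM => //; exact: polyfun_conj.
by congr cintegral; apply/funext => g; rewrite conjcM mulrCA.
Qed.

Lemma inner_prodBl u v w : polyfun u -> polyfun v -> polyfun w ->
  inner_prod mu (fun g => u g - v g) w = inner_prod mu u w - inner_prod mu v w.
Proof.
move=> pu pv pw; have pw' := polyfun_conj pw.
rewrite /inner_prod -[- cintegral _ _]mulN1r -cintegralZ; last exact: polyfunM.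
rewrite -cintegralD; [|exact: polyfunM|by apply: polyfunZ; exact: polyfunM].
by congr cintegral; apply/funext => g; rewrite mulrBl mulN1r.
Qed.

(** Polynomiality is carried along with orthogonality because additivity of the integral requires it
    at each step of an induction over sums. *)
Definition polyfun_orth u v := polyfun v /\ inner_prod mu u v = 0.

Lemma polyfun_orth_sum (I : eqType) (s : seq I) (F : I -> SO3 R -> R[i]) u :
  polyfun u -> (forall i, i \in s -> polyfun_orth u (F i)) ->
  polyfun_orth u (fun g => \sum_(i <- s) F i g).
Proof.
move=> pu; elim: s => [|a s IH] oF.
  rewrite (_ : (fun g => _) = fun=> 0); last by apply/funext => g; rewrite big_nil.
  split; first exact: polyfun_cst.
  rewrite /inner_prod (_ : (fun g => _) = fun=> 0) ?cintegral0//.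
  by apply/funext => g; rewrite conjc0 mulr0.
rewrite (_ : (fun g => _) = fun g => F a g + \sum_(i <- s) F i g); last first.
  by apply/funext => g; rewrite big_cons.
have [pa a0] := oF a (mem_head _ _).
have [ps s0] : polyfun_orth u (fun g => \sum_(i <- s) F i g).
  by apply: IH => i si; apply: oF; rewrite inE si orbT.
by split; [exact: polyfunD|rewrite inner_prodDr// a0 s0 addr0].
Qed.

(** The family [E] is left general so that the lemma serves both the Wigner-D functions and their
    translates. *)
Lemma polyfun_orth_span N u (c : nat -> int -> int -> R[i]) E : polyfun u ->
  (forall n k l, Jset N n k l -> polyfun_orth u (E n k l)) ->
  polyfun_orth u (fun g => \sum_(0 <= n < N.+1) \sum_(k <- zball n) \sum_(l <- zball n)
    c n k l * E n k l g).
Proof.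
move=> pu oE; apply: polyfun_orth_sum => // n; rewrite mem_index_iota => /andP[_ nN].
apply: polyfun_orth_sum => // k; rewrite mem_zball => kn.
apply: polyfun_orth_sum => // l; rewrite mem_zball => ln.
have [pE E0] : polyfun_orth u (E n k l) by apply: oE; rewrite /Jset kn ln -ltnS nN.
by split; [exact: polyfunZ|rewrite inner_prodZr// E0 mulr0].
Qed.

Lemma bandlimited_polyfun N f : bandlimited N f -> polyfun f.
Proof.
move=> [c fE]; have -> := funext fE.
by do 3 (apply: polyfun_sum => ? _); apply: polyfunZ; exact: wignerD_polyfun.
Qed.

Hypothesis haar : is_haar mu.

(** [F] stands for a translation by [Rz t] or [Ry pi] on either side. The last hypothesis on [F]
    makes the difference [u] orthogonal to the translated Wigner-D functions as well, and [f \o F]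
    expands in those with the coefficients of [f]. *)
Lemma bandlimited_invariantP N f (F : SO3 R -> SO3 R) : bandlimited N f ->
  (forall u, polyfun u -> polyfun (u \o F)) ->
  (forall n k l, Jset N n k l -> exists z k' l', Jset N n k' l' /\
    forall g, wignerD n k l (F g) = z * wignerD n k' l' g) ->
  (forall g, f g = f (F g)) <->
  (forall n k l, Jset N n k l -> harmonic_coef mu (f \o F) n k l = harmonic_coef mu f n k l).
Proof.
move=> bf pF DF; have pf := bandlimited_polyfun bf; have pfF := pF f pf.
split=> [e n k l _|e].
  by congr harmonic_coef; apply/funext => g; rewrite /= -e.
pose u g := (f \o F) g - f g; have pu : polyfun u by exact: polyfunB.
have uD n k l : Jset N n k l -> polyfun_orth u (wignerD n k l).
  move=> J; split; first exact: wignerD_polyfun.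
  rewrite inner_prodBl//; last exact: wignerD_polyfun.
  by apply/eqP; rewrite subr_eq0; apply/eqP/e.
have uDF n k l : Jset N n k l -> polyfun_orth u (fun g => wignerD n k l (F g)).
  move=> J; split; first exact/(pF _ (wignerD_polyfun n k l)).
  have [z [k' [l' [J' DE]]]] := DF n k l J.
  have [pD D0] := uD _ _ _ J'.
  by rewrite (funext DE) inner_prodZr// D0 mulr0.
have [c fE] := bf.
have [_ uf] := polyfun_orth_span c pu uD.
have [_ ufF] := polyfun_orth_span c pu uDF.
have uf0 : inner_prod mu u f = 0 by rewrite (funext fE).
have ufF0 : inner_prod mu u (f \o F) = 0.
  by rewrite -[RHS]ufF; congr inner_prod; apply/funext => g; exact: fE.
have uu : inner_prod mu u u = 0.
  have -> : inner_prod mu u u = inner_prod mu u (fun g => (f \o F) g + (-1) * f g).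
    by congr inner_prod; apply/funext => g; rewrite mulN1r.
  rewrite inner_prodDr//; last exact: polyfunZ.
  by rewrite inner_prodZr// uf0 mulr0 addr0.
by move=> g; apply/esym/eqP; rewrite -subr_eq0; apply/eqP/(inner_prod_definite haar pu uu).
Qed.

Lemma inner_prod_mull h u v : polyfun u -> polyfun v ->
  inner_prod mu (fun g => u (h * g)%g) v = inner_prod mu u (fun g => v (h^-1 * g)%g).
Proof.
move=> pu pv; rewrite /inner_prod.
rewrite -(cintegral_mull haar h^-1%g); last first.
  by apply: polyfunM; [exact: polyfun_mull|exact: polyfun_conj].
by congr cintegral; apply/funext => g; rewrite mulVKg.
Qed.

Lemma inner_prod_mulr h u v : polyfun u -> polyfun v ->
  inner_prod mu (fun g => u (g * h)%g) v = inner_prod mu u (fun g => v (g * h^-1)%g).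
Proof.
move=> pu pv; rewrite /inner_prod.
rewrite -(cintegral_mulr haar h^-1%g); last first.
  by apply: polyfunM; [exact: polyfun_mulr|exact: polyfun_conj].
by congr cintegral; apply/funext => g; rewrite mulgVK.
Qed.

Lemma Rz_inv t : (Rz t)^-1%g = Rz (- t) :> SO3 R.
Proof. by apply: (mulgI (Rz t)); rewrite mulgV Rz_mul subrr Rz0. Qed.

Lemma Ry_pi_inv : (Ry pi)^-1%g = Ry pi :> SO3 R.
Proof.
apply: (mulgI (Ry pi)); rewrite mulgV; apply: so3P => i j.
rewrite so3_mul_entry sum_ord3 !mxE.
by case: i j => [[|[|[|//]]] ?] [[|[|[|//]]] ?] /=; rewrite ?cospi ?sinpi; ring.
Qed.

Lemma conj_expN1z (m : int) : ((-1) ^ m)^*%C = (-1) ^ m :> R[i].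
Proof. by rewrite -realC_expN1z conjc_real. Qed.

Lemma harmonic_coef_Rz_mul f n k l t : polyfun f ->
  harmonic_coef mu (fun g => f (Rz t * g)%g) n k l =
  expi (- (k%:~R * t)) * harmonic_coef mu f n k l.
Proof.
move=> pf; rewrite /harmonic_coef inner_prod_mull//; last exact: wignerD_polyfun.
rewrite Rz_inv (funext (wignerD_Rz_mul n k l (- t))) inner_prodZr ?conj_expi//.
- by rewrite mulrN opprK.
- exact: wignerD_polyfun.
Qed.

Lemma harmonic_coef_mul_Rz f n k l t : polyfun f ->
  harmonic_coef mu (fun g => f (g * Rz t)%g) n k l =
  expi (- (l%:~R * t)) * harmonic_coef mu f n k l.
Proof.
move=> pf; rewrite /harmonic_coef inner_prod_mulr//; last exact: wignerD_polyfun.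
rewrite Rz_inv (funext (wignerD_mul_Rz n k l (- t))) inner_prodZr ?conj_expi//.
- by rewrite mulrN opprK.
- exact: wignerD_polyfun.
Qed.

Lemma harmonic_coef_Ry_mul f n k l : polyfun f -> (`|k| <= n)%N -> (`|l| <= n)%N ->
  harmonic_coef mu (fun g => f (Ry pi * g)%g) n k l =
  (-1) ^ (n%:Z + k) * harmonic_coef mu f n (- k) l.
Proof.
move=> pf kn ln; rewrite /harmonic_coef inner_prod_mull//; last exact: wignerD_polyfun.
rewrite Ry_pi_inv (funext (fun g => wignerD_Ry_mul g kn ln)) inner_prodZr ?conj_expN1z//.
exact: wignerD_polyfun.
Qed.

Lemma harmonic_coef_mul_Ry f n k l : polyfun f -> (`|k| <= n)%N -> (`|l| <= n)%N ->
  harmonic_coef mu (fun g => f (g * Ry pi)%g) n k l =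
  (-1) ^ (n%:Z + l) * harmonic_coef mu f n k (- l).
Proof.
move=> pf kn ln; rewrite /harmonic_coef inner_prod_mulr//; last exact: wignerD_polyfun.
rewrite Ry_pi_inv (funext (fun g => wignerD_mul_Ry g kn ln)) inner_prodZr ?conj_expN1z//.
exact: wignerD_polyfun.
Qed.

End HarmonicCoefficients.

(** * Cyclic and dihedral symmetries *)

Section Symmetries.
Context {R : realType}.
Implicit Types (G : set (SO3 R)) (N n r : nat) (k l : int).

Lemma expi_mulz_2pi k : expi (k%:~R * (2 * pi)) = 1 :> R[i].
Proof. by rewrite mulr_natl expi_mulz /expi cos2pi sin2pi exp1rz. Qed.

(** With m the residue of [k], the phase has angle 2y up to sign and full turns, where y = m pi / r.
    If m were nonzero, y would lie strictly between 0 and pi, and cos 2y = 1 - 2 sin^2 y would be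
    less than 1. *)
Lemma expi_root_eq1 r k : (0 < r)%N ->
  expi (- (k%:~R * (2 * pi * 1%:R / r%:R))) = 1 :> R[i] -> (k %% r)%Z = 0.
Proof.
move=> r0; have rR : 0 < r%:R :> R by rewrite ltr0n.
have kE := divz_eq k r; set m := (k %% r)%Z in kE *.
have m0 : 0 <= m by rewrite modz_ge0; lia.
have mr : m < r by rewrite ltz_pmod.
pose y : R := m%:~R * pi / r%:R.
rewrite expiN => /(congr1 GRing.inv); rewrite invrK invr1.
have -> : k%:~R * (2 * pi * 1%:R / r%:R) = (k %/ r)%Z%:~R * (2 * pi) + (y + y).
  by rewrite {1}kE intrD intrM /y pmulrn; field; rewrite lt0r_neq0.
rewrite expiD expi_mulz_2pi mul1r => /(congr1 (@complex.Re R)) /=.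
rewrite cosD => c1; apply/eqP; apply: contraT => mn0.
have y0 : 0 < y by rewrite divr_gt0// mulr_gt0 ?pi_gt0// ltr0z lt_def mn0.
have ypi : y < pi.
  by rewrite ltr_pdivrMr// mulrC ltr_pM2l ?pi_gt0// pmulrn ltr_int.
have sy : 0 < sin y by rewrite sin_gt0_pi// y0 ypi.
have := sin2cos2 y; move: (mulr_gt0 sy sy) c1; rewrite !expr2 => ss c1 sc; lra.
Qed.

Lemma cyclic_eigenvalueP r k (z : R[i]) : (0 < r)%N ->
  (forall s, (s < r)%N -> expi (- (k%:~R * (2 * pi * s%:R / r%:R))) * z = z) <->
  ((k %% r)%Z <> 0 -> z = 0).
Proof.
move=> r0; split=> [ez kr|z0 s sr].
  (* The generator s = 1 is used below, which requires 1 < r; for r = 1 every residue is 0. *)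
  have r1 : (1 < r)%N.
    by move: kr; case: r r0 {ez} => [|[|]]//; rewrite modz1.
  apply/eqP; apply: contraT => zn0; case: kr; apply: expi_root_eq1 => //.
  by apply: (mulIf zn0); rewrite mul1r ez.
have [/dvdz_mod0P/dvdzP[q ->]|/eqP/z0 ->] := eqVneq (k %% r)%Z 0; last by rewrite mulr0.
have -> : - ((q * r)%:~R * (2 * pi * s%:R / r%:R)) = (- (q * s%:Z))%:~R * (2 * pi) :> R.
  by rewrite mulrNz !intrM !pmulrn; field; rewrite pnatr_eq0; lia.
by rewrite expi_mulz_2pi mul1r.
Qed.

Lemma dihedral_subP r G : (0 < r)%N -> G 1%g ->
  (forall x y, G x -> G y -> G (x * y)%g) ->
  dihedral_group r `<=` G <-> cyclic_group r `<=` G /\ G (Ry pi).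
Proof.
move=> r0 G1 GM; split=> [DG|[CG GR] _ [x Cx [s /= s2 <-]]].
  have C1 : cyclic_group r 1%g.
    by exists 0%N => //=; rewrite mulr0 mul0r Rz0.
  split=> [x Cx|]; apply: DG.
    by exists x => //; exists 0%N => //; rewrite mulr0 Ry0 mulg1.
  by exists 1%g => //; exists 1%N => //; rewrite mulr1 mul1g.
apply: GM; first exact: CG.
by case: s s2 => [|[|]]// _; rewrite ?mulr0 ?Ry0 ?mulr1.
Qed.

(** Reduces each part of the theorem to two equivalences: one between the symmetry and the harmonic
    coefficients, posed for the full symmetry group, and one between the two coefficient
    conditions. *)
Lemma symmetry_tfaeI (S G H : set (SO3 R)) (P Q : Prop) : S `<=` G ->
  (H `<=` G <-> P) -> (P <-> Q) -> symmetry_tfae S G H P Q.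
Proof.
move=> SG HP PQ; split.
- by move=> HS; have /HP p := subset_trans HS SG; split; [|exact/PQ].
- by tfae; tauto.
- by move=> GS; have -> : S = G; [exact/seteqP|tfae; tauto].
Qed.

Variables (mu : probability (SO3 R) R) (N : nat) (f : SO3 R -> R[i]).
Hypotheses (haar : is_haar mu) (bf : bandlimited N f).
Let fh := harmonic_coef mu f.
Let pf : polyfun f := bandlimited_polyfun bf.

(** Invariance under [Rz t] says that each coefficient is fixed by the factor e^(-ikt); the angles
    of the cyclic group then allow a nonzero coefficient only if [r] divides [k]. *)
Lemma right_cyclicP r : (0 < r)%N ->
  cyclic_group r `<=` right_symmetries f <->
  (forall n k l, Jset N n k l -> (k %% r)%Z <> 0 -> fh n k l = 0).
Proof.
move=> r0.
have RzP t : right_symmetries f (Rz t) <->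
    (forall n k l, Jset N n k l -> expi (- (k%:~R * t)) * fh n k l = fh n k l).
  rewrite /right_symmetries /= (bandlimited_invariantP haar bf (F := fun g => (Rz t * g)%g)).
  - by split=> e n k l J; have := e n k l J; rewrite harmonic_coef_Rz_mul.
  - by move=> u; exact: polyfun_mull.
  - by move=> n k l J; exists (expi (- (k%:~R * t))), k, l; split=> // g; exact: wignerD_Rz_mul.
split=> [CG n k l J|e _ [s /= sr <-]].
  by apply/cyclic_eigenvalueP => // s sr; apply: (RzP _).1 => //; apply: CG; exists s.
by apply/RzP => n k l J; move: s sr; apply/cyclic_eigenvalueP => //; exact: e.
Qed.

Lemma left_cyclicP r : (0 < r)%N ->
  cyclic_group r `<=` left_symmetries f <->
  (forall n k l, Jset N n k l -> (l %% r)%Z <> 0 -> fh n k l = 0).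
Proof.
move=> r0.
have RzP t : left_symmetries f (Rz t) <->
    (forall n k l, Jset N n k l -> expi (- (l%:~R * t)) * fh n k l = fh n k l).
  rewrite /left_symmetries /= (bandlimited_invariantP haar bf (F := fun g => (g * Rz t)%g)).
  - by split=> e n k l J; have := e n k l J; rewrite harmonic_coef_mul_Rz.
  - by move=> u; exact: polyfun_mulr.
  - by move=> n k l J; exists (expi (- (l%:~R * t))), k, l; split=> // g; exact: wignerD_mul_Rz.
split=> [CG n k l J|e _ [s /= sr <-]].
  by apply/cyclic_eigenvalueP => // s sr; apply: (RzP _).1 => //; apply: CG; exists s.
by apply/RzP => n k l J; move: s sr; apply/cyclic_eigenvalueP => //; exact: e.
Qed.

Lemma right_RyP : right_symmetries f (Ry pi) <->
  (forall n k l, Jset N n k l -> fh n k l = (-1) ^ (n%:Z + k) * fh n (- k) l).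
Proof.
rewrite /right_symmetries /= (bandlimited_invariantP haar bf (F := fun g => (Ry pi * g)%g)).
- by split=> e n k l J; have /and3P[_ kn ln] := J; have := e n k l J;
    rewrite harmonic_coef_Ry_mul.
- by move=> u; exact: polyfun_mull.
- move=> n k l /and3P[nN kn ln]; exists ((-1) ^ (n%:Z + k)), (- k), l.
  by rewrite /Jset nN abszN kn ln; split=> // g; exact: wignerD_Ry_mul.
Qed.

Lemma left_RyP : left_symmetries f (Ry pi) <->
  (forall n k l, Jset N n k l -> fh n k l = (-1) ^ (n%:Z + l) * fh n k (- l)).
Proof.
rewrite /left_symmetries /= (bandlimited_invariantP haar bf (F := fun g => (g * Ry pi)%g)).
- by split=> e n k l J; have /and3P[_ kn ln] := J; have := e n k l J;
    rewrite harmonic_coef_mul_Ry.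
- by move=> u; exact: polyfun_mulr.
- move=> n k l /and3P[nN kn ln]; exists ((-1) ^ (n%:Z + l)), k, (- l).
  by rewrite /Jset nN abszN kn ln; split=> // g; exact: wignerD_mul_Ry.
Qed.

Lemma right_dihedralP r : (0 < r)%N ->
  dihedral_group r `<=` right_symmetries f <->
  cyclic_group r `<=` right_symmetries f /\ right_symmetries f (Ry pi).
Proof.
move=> r0; apply: dihedral_subP => //; first by move=> g; rewrite mul1g.
by move=> x y fx fy g; rewrite fy fx mulgA.
Qed.

Lemma left_dihedralP r : (0 < r)%N ->
  dihedral_group r `<=` left_symmetries f <->
  cyclic_group r `<=` left_symmetries f /\ left_symmetries f (Ry pi).
Proof.
move=> r0; apply: dihedral_subP => //; first by move=> g; rewrite mulg1.
by move=> x y fx fy g; rewrite fx fy mulgA.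
Qed.

End Symmetries.

(** * Transfer of coefficient conditions through the Wigner transform *)

Section TransformedCoefficients.
Context {R : realType}.
Implicit Types (N n : nat) (k j l : int) (fh : nat -> int -> int -> R[i]).

Lemma wigner_transform0 N k j l : wigner_transform N (fun _ _ _ => 0) k j l = 0 :> R[i].
Proof. by rewrite /wigner_transform big1 ?mulr0// => n _; rewrite mulr0. Qed.

(** Vanishing is equality with the zero family, so injectivity applies pair by pair. The condition
    [C] has to be even because the transform at (k, l) reads the coefficients at (-k, -l). *)
Lemma wigner_transform_vanishP N fh (C : int -> int -> Prop) :
  (forall k l, C (- k) (- l) <-> C k l) ->
  (forall n k l, Jset N n k l -> C k l -> fh n k l = 0) <->
  (forall k j l, k \in zball N -> j \in zball N -> l \in zball N ->
     C k l -> wigner_transform N fh k j l = 0).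
Proof.
move=> CN; split=> [e k j l kN jN lN Ckl|e n k l J Ckl].
  rewrite -[RHS](wigner_transform0 N k j l).
  by apply: (wigner_transformP N fh (fun _ _ _ => 0) k l).1 => // n J; apply: e => //; exact/CN.
have [nN kn ln] := and3P J.
rewrite -(opprK k) -(opprK l).
apply: (wigner_transformP N fh (fun _ _ _ => 0) (- k) (- l)).2; last by rewrite !opprK.
move=> j jN; rewrite wigner_transform0; apply: e => //; last exact/CN.
- by rewrite mem_zball abszN (leq_trans kn).
- by rewrite mem_zball abszN (leq_trans ln).
Qed.

Lemma wigner_transform_eqP N fh1 fh2 :
  (forall n k l, Jset N n k l -> fh1 n k l = fh2 n k l) <->
  (forall k j l, k \in zball N -> j \in zball N -> l \in zball N ->
     wigner_transform N fh1 k j l = wigner_transform N fh2 k j l).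
Proof.
split=> [e k j l kN jN lN|e n k l J].
  by apply: (wigner_transformP N fh1 fh2 k l).1 => // n; exact: e.
have [nN kn ln] := and3P J.
rewrite -(opprK k) -(opprK l).
apply: (wigner_transformP N fh1 fh2 (- k) (- l)).2; last by rewrite !opprK.
by move=> j jN; apply: e; rewrite // mem_zball abszN (leq_trans _ nN).
Qed.

End TransformedCoefficients.


Lemma modzN_neq0 (k d : int) : ((- k) %% d)%Z <> 0 <-> (k %% d)%Z <> 0.
Proof.
have N0 m : (m %% d)%Z = 0 -> ((- m) %% d)%Z = 0.
  by move=> /dvdz_mod0P/dvdzP[q ->]; rewrite -mulNr modzMl.
by split; apply: contra_not => /N0; rewrite ?opprK.
Qed.

Theorem theorem4p5 (R : realType) (mu : probability (SO3 R) R)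
    (S_R S_L : set (SO3 R)) (N : nat) (f : SO3 R -> R[i]) :
  is_haar mu ->
  finite_subgroup S_R -> finite_subgroup S_L ->
  bandlimited N f -> has_symmetry S_R S_L f ->
  let fh := harmonic_coef mu f in
  let gh := wigner_transform N fh in
  forall r : nat, (0 < r)%N ->
  let G_R := right_symmetries f in
  let G_L := left_symmetries f in
  let a_ii := forall n k l, Jset N n k l -> (k %% r)%Z <> 0 -> fh n k l = 0 in
  let a_iii := forall k j l, k \in zball N -> j \in zball N -> l \in zball N ->
    (k %% r)%Z <> 0 -> gh k j l = 0 in
  let c_ii := forall n k l, Jset N n k l -> (l %% r)%Z <> 0 -> fh n k l = 0 in
  let c_iii := forall k j l, k \in zball N -> j \in zball N -> l \in zball N ->
    (l %% r)%Z <> 0 -> gh k j l = 0 in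
  [/\ symmetry_tfae S_R G_R (cyclic_group r) a_ii a_iii,
      symmetry_tfae S_R G_R (dihedral_group r)
        (a_ii /\ forall n k l, Jset N n k l ->
           fh n k l = (-1) ^ (n%:Z + k) * fh n (- k) l)
        (a_iii /\ forall k j l,
           k \in zball N -> j \in zball N -> l \in zball N ->
           gh k j l = (-1) ^ j * gh (- k) j l),
      symmetry_tfae S_L G_L (cyclic_group r) c_ii c_iii
    & symmetry_tfae S_L G_L (dihedral_group r)
        (c_ii /\ forall n k l, Jset N n k l ->
           fh n k l = (-1) ^ (n%:Z + l) * fh n k (- l))
        (c_iii /\ forall k j l,
           k \in zball N -> j \in zball N -> l \in zball N ->
           gh k j l = (-1) ^ j * gh k j (- l))].
Proof.
move=> haar [_ SR1 _ _] [_ SL1 _ _] bf sym fh gh r r0 G_R G_L a_ii a_iii c_ii c_iii.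
(* Taking the identity in the opposite group isolates the one-sided symmetry. *)
have SG_R : S_R `<=` G_R.
  by move=> s Ss g; rewrite (sym g s 1%g)// mulg1.
have SG_L : S_L `<=` G_L.
  by move=> t St g; rewrite (sym g 1%g t)// mul1g.
have a_iff : a_ii <-> a_iii.
  by apply: (@wigner_transform_vanishP _ N fh (fun k _ => (k %% r)%Z <> 0)) => k _; exact: modzN_neq0.
have c_iff : c_ii <-> c_iii.
  by apply: (@wigner_transform_vanishP _ N fh (fun _ l => (l %% r)%Z <> 0)) => _ l; exact: modzN_neq0.
(* The reflection identity is an equality of two coefficient families, hence equivalent to equality
   of their transforms; [wigner_transform_oppl] evaluates the second one. *)
have b_iff := wigner_transform_eqP N fh (fun n k l => (-1) ^ (n%:Z + k) * fh n (- k) l).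
have d_iff := wigner_transform_eqP N fh (fun n k l => (-1) ^ (n%:Z + l) * fh n k (- l)).
split; apply: symmetry_tfaeI => //.
- exact: right_cyclicP.
- rewrite right_dihedralP// (right_cyclicP haar bf)// (right_RyP haar bf); tauto.
- by rewrite a_iff b_iff; split=> -[? e]; split=> // k j l kN jN lN;
    have := e k j l kN jN lN; rewrite wigner_transform_oppl.
- exact: left_cyclicP.
- rewrite left_dihedralP// (left_cyclicP haar bf)// (left_RyP haar bf); tauto.
- by rewrite c_iff d_iff; split=> -[? e]; split=> // k j l kN jN lN;
    have := e k j l kN jN lN; rewrite wigner_transform_oppr.
Qed.
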